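(* Let $M$ be a matroid with lattice of flats $\mathcal L$ ordered by inclusion. Then $(\mathcal L,N,C,\iota)$ is a cell datum for $S(M)$.
   Context: $M$ is a matroid on a finite ground set $E$ with lattice of flats $\mathcal L$ and rank function $\rho$. For flats write $K\lessdot L$ (or $L\gtrdot K$) if $L$ covers $K$. A flag path is a finite sequence $(K_1,\dots,K_l)$ of flats with $K_i\lessdot K_{i+1}$ or $K_i\gtrdot K_{i+1}$ for each $i=1,\dots,l-1$. The free $\mathbb Z$-module on the set of all flag paths is an algebra under concatenation: $(K_1,\dots,K_l)\cdot(L_1,\dots,L_{l'})=(K_1,\dots,K_l=L_1,L_2,\dots,L_{l'})$ if $K_l=L_1$ and $0$ otherwise. The extended matroidal Schur algebra $S(M)$ is the quotient of this algebra by the following relations: (FS) for flats $L<K$ with $\rho(K)=\rho(L)+2$: $\sum_X(L\lessdot X\lessdot K)=0=\sum_X(K\gtrdot X\gtrdot L)$, where the sums are over all flats $X$ with $K\gtrdot X\gtrdot L$; ($\bigwedge$) for $K\lessdot L$ and $K'\lessdot L$: $(K\lessdot L\gtrdot K')$ equals $|L\setminus K|\,(K)$ if $K=K'$; $-(K\gtrdot K\cap K'\lessdot K')$ if $K\ne K'$ and $K\cap K'\lessdot K$; and $0$ otherwise. Data. Fix a labelling of flats, meaning simply a map $\ell:\mathcal L\to E$ such that $\ell(K)\in K$ for each $K$ (for example, one could order the set $E$ and let $\ell(K)$ be the least element of $K$). A flag $(K_k\gtrdot\dots\gtrdot K_1\gtrdot K_0)$ is neat (with respect to $\ell$) if $\ell(K_i)\in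 K_i\setminus K_{i-1}$ for all $i=1,\dots,k$. The map $\iota$ is the involution of $S(M)$ that sends a flag path $(K_1,\dots,K_k)$ to the flag path $(K_k,\dots,K_1)$ obtained by listing the same flats in the reverse order. For each flat $K$, $N(K)$ denotes the set of neat flags $(K_k\gtrdot K_{k-1}\gtrdot\dots\gtrdot K_1\gtrdot K)$. For any pair of elements $F=(K_k,\dots,K_1,K)$ and $G=(L_l,\dots,L_1,K)$ of $N(K)$, $C^K_{FG}=F\cdot\iota(G)=(K_k\gtrdot\dots\gtrdot K_1\gtrdot K\lessdot L_1\lessdot\dots\lessdot L_l)$. Cellular algebra. Let $R$ be a commutative Noetherian integral domain (here $R=\mathbb Z$). An $R$-algebra $A$ is called a cellular algebra with cell datum $(\Lambda,N,C,i)$ where: $\Lambda$ is a finite partially ordered set; for each $\lambda\in\Lambda$ there is an associated non-empty finite set $N(\lambda)$; $i:A\to A$ is an $R$-linear anti-automorphism with $i^2=\mathrm{id}_A$; and for each $\lambda\in\Lambda$ and $S,T\in N(\lambda)$ there is an element $C^\lambda_{ST}\in A$; such that (1) $\{C^\lambda_{ST}\mid\lambda\in\Lambda,\ S,T\in N(\lambda)\}$ is an $R$-basis for $A$; (2) $i(C^\lambda_{ST})=C^\lambda_{TS}$; (3) for each $\lambda\in\Lambda$, $S,T\in N(\lambda)$ and $a\in A$, one has $aC^\lambda_{ST}=\left(\sum_{U\in N(\lambda)}r_a(U,S)C^\lambda_{UT}\right)+r'$, where $r'$ is a linear combination of basis elements with upper index $\mu$ strictly smaller than $\lambda$, and where the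 coefficients $r_a(U,S)\in R$ do not depend on $T$.
   Formalization: The labelling may depend on the base flat K: it assigns to each flat L > K an element of L∖K, and N(K) consists of flags neat for that labelling; with one map ℓ(K)∈K as in the text the C^K_FG can fail to span (e.g. Boolean matroid of rank 2). *)

(* Defs.v *)
From HB Require Import structures.
From mathcomp Require Import all_boot all_order all_algebra.
From mathcomp Require Import finmap monalg.
From mathcomp Require boolp.

Set Implicit Arguments.
Unset Strict Implicit.
Unset Printing Implicit Defensive.

Import Order.TTheory GRing.Theory Num.Theory.
Local Open Scope ring_scope.
Local Open Scope quotient_scope.

Record matroid (E : finType) := Matroid {
  rk : {set E} -> nat;
  rk_card : forall A, (rk A <= #|A|)%N;
  rk_mono : forall A B : {set E}, A \subset B -> (rk A <= rk B)%N;
  rk_submod : forall A B, (rk (A :|: B) + rk (A :&: B) <= rk A + rk B)%N }.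

Section Flats.
Variables (E : finType) (M : matroid E).

Definition is_flat (A : {set E}) : bool :=
  [forall x, (x \notin A) ==> (rk M A < rk M (x |: A))%N].

Record flat := Flat { fset_of :> {set E}; _ : is_flat fset_of }.

HB.instance Definition _ := [isSub for fset_of].
HB.instance Definition _ := [Finite of flat by <:].

Definition rho (K : flat) : nat := rk M K.

Fact flat_display : Order.disp_t. Proof. exact: Order.Disp tt tt. Qed.

Definition flat_le (K L : flat) : bool := fset_of K \subset fset_of L.

Fact flat_le_refl : reflexive flat_le.
Proof. by move=> K; apply: subxx. Qed.
Fact flat_le_anti : antisymmetric flat_le.
Proof. by move=> K L KL; apply/val_inj/eqP; rewrite eqEsubset. Qed.
Fact flat_le_trans : transitive flat_le.
Proof. by move=> L K H; apply: subset_trans. Qed.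

HB.instance Definition _ := Order.Le_isPOrder.Build flat_display flat
  flat_le_refl flat_le_anti flat_le_trans.

Lemma flat_leE (K L : flat) : (K <= L)%O = (fset_of K \subset fset_of L).
Proof. by []. Qed.

Lemma flat_ltE (K L : flat) : (K < L)%O = (fset_of K \proper fset_of L).
Proof. by rewrite lt_neqAle flat_leE properEneq -(inj_eq val_inj). Qed.

Fact flatI_subproof (K L : flat) : is_flat (K :&: L).
Proof.
suff hI (A B : flat) x : x \notin fset_of A ->
    (rk M (A :&: B) < rk M (x |: (A :&: B)))%N.
  apply/forallP=> x; apply/implyP; rewrite inE negb_and => /orP[]; first exact: hI.
  by rewrite setIC; apply: hI.
move=> xA; have := rk_submod M A (x |: (A :&: B)).
have -> : A :|: (x |: A :&: B) = x |: A.
  by rewrite setUCA; congr (_ :|: _); apply/setUidPl/subsetIl.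
have -> : A :&: (x |: A :&: B) = A :&: B.
  rewrite setIUr setIA setIid; apply/setUidPr/subsetP=> y.
  by rewrite !inE => /andP[yA /eqP yx]; rewrite yx (negPf xA) in yA.
have := forallP (valP A) x; rewrite xA /= => lt1 le2.
by rewrite -(ltn_add2l (rk M A)); apply: leq_trans le2; rewrite ltn_add2r.
Qed.

Definition flatI (K L : flat) : flat := Flat (flatI_subproof K L).

Definition covers (K L : flat) : bool :=
  (K < L)%O && [forall X : flat, ~~ ((K < X)%O && (X < L)%O)].

Definition adj (K L : flat) : bool := covers K L || covers L K.

Lemma adj_sym : symmetric adj. Proof. by move=> K L; rewrite /adj orbC. Qed.

Lemma flat_lt_rho (K L : flat) : (K < L)%O -> (rho K < rho L)%N.
Proof.
rewrite flat_ltE => /properP[KL [x xL xK]].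
have := forallP (valP K) x; rewrite xK /= => /leq_trans; apply.
by apply: rk_mono; rewrite subUset sub1set xL.
Qed.

Lemma coversP (K L : flat) :
  reflect ((K < L)%O /\ rho L = (rho K).+1) (covers K L).
Proof.
apply: (iffP andP) => [[KL noX] | [KL rKL]]; split=> //; last first.
  apply/forallP=> X; apply/negP=> /andP[/flat_lt_rho KX /flat_lt_rho].
  by rewrite rKL ltnS leqNgt KX.
apply/eqP; rewrite eqn_leq [X in _ && X]flat_lt_rho // andbT.
have /properP[subKL [x xL xK]] : fset_of K \proper fset_of L by rewrite -flat_ltE.
pose P (B : {set E}) := (x |: K \subset B) && (rk M B == rk M (x |: K)).
have [B /maxsetP[/andP[xKB /eqP rB] maxB] _] :
  {B | maxset P B & x |: K \subset B}.
  by apply: maxset_exists; rewrite /P subxx eqxx.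
have flB : is_flat B.
  apply/forallP=> y; apply/implyP=> yB; rewrite ltn_neqAle rk_mono ?subsetUr //.
  rewrite andbT; apply: contra yB => /eqP eqB.
  rewrite -(maxB (y |: B)) ?subsetUr ?setU11 // /P -eqB rB eqxx andbT.
  exact: subset_trans xKB (subsetUr _ _).
have KX : (K < flatI (Flat flB) L)%O.
  rewrite flat_ltE /=; apply/properP; split.
    by rewrite subsetI subKL (subset_trans _ xKB) ?subsetUr.
  by exists x; rewrite // inE xL (subsetP xKB) ?setU11.
have XL : (flatI (Flat flB) L <= L)%O by rewrite flat_leE subsetIr.
have {noX} := forallP noX (flatI (Flat flB) L).
rewrite KX /= lt_neqAle XL andbT negbK => /eqP/(congr1 fset_of)/= eqL.
have LB : fset_of L \subset B by rewrite -eqL subsetIl.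
apply: leq_trans (rk_mono M LB) _; rewrite rB.
apply: leq_trans (leq_addr (rk M ([set x] :&: K)) _) _.
apply: leq_trans (rk_submod M _ _) _.
rewrite -[leqRHS]add1n leq_add2r; apply: leq_trans (rk_card M _) _.
by rewrite cards1.
Qed.

(* The pair (K, [:: K_2; ..; K_l]) stands for the sequence (K, K_2, .., K_l),  *)
(* so that flag paths are nonempty.                                            *)
Record flag_path := FlagPath {
  fp_pair : flat * seq flat;
  _ : path adj fp_pair.1 fp_pair.2 }.

HB.instance Definition _ := [isSub for fp_pair].
HB.instance Definition _ := [Countable of flag_path by <:].

Definition path_algebra : Type := {malg int[flag_path]}.

HB.instance Definition _ := GRing.Lmodule.on path_algebra.

(* The basis element (K, K_2, .., K_l) when this is a flag path, 0 otherwise. *)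
Definition pel (K : flat) (s : seq flat) : path_algebra :=
  if insub (K, s) is Some p then << p >> else 0.

End Flats.

Arguments flat {E} M.
Arguments flag_path {E} M.
Arguments path_algebra {E} M.

Section ZmodMorphism.
Variables (V W : zmodType) (f : V -> W) (hf : zmod_morphism f).

Let g : {additive V -> W} :=
  HB.pack f (GRing.isZmodMorphism.Build V W f hf).

Lemma zm0 : f 0 = 0. Proof. exact: (raddf0 g). Qed.

Lemma zm_sum (I : Type) (r : seq I) (P : pred I) (F : I -> V) :
  f (\sum_(i <- r | P i) F i) = \sum_(i <- r | P i) f (F i).
Proof. exact: (raddf_sum g). Qed.

Lemma zm_expand (I : Type) (r : seq I) (F : I -> V) (n : I -> int) :
  f (\sum_(i <- r) F i *~ n i) = \sum_(i <- r) f (F i) *~ n i.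
Proof. by rewrite zm_sum; apply: eq_bigr => i _; apply: (raddfMz g). Qed.

End ZmodMorphism.

Section LinearExtension.
Variables (K : choiceType) (V : zmodType).
Implicit Types (h : K -> V) (g : {malg int[K]}).

Definition mlin h g : V := \sum_(k <- msupp g) h k *~ g@_k.

Lemma mlinEw h (d : {fset K}) g : (msupp g `<=` d)%fset ->
  mlin h g = \sum_(k <- d) h k *~ g@_k.
Proof.
move=> le; rewrite /mlin (big_fset_incl _ le) => //= x xd /mcoeff_outdom ->.
by rewrite mulr0z.
Qed.

Lemma mlinD h : {morph mlin h : x y / x + y}.
Proof.
move=> x y; rewrite (mlinEw h (msuppD_le x y)).
rewrite (mlinEw h (fsubsetUl _ (msupp y))) (mlinEw h (fsubsetUr (msupp x) _)).
by rewrite -big_split; apply: eq_bigr => k _; rewrite mcoeffD mulrzDr.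
Qed.

Lemma mlin_is_zmod_morphism h : zmod_morphism (mlin h).
Proof.
have h0 : mlin h 0 = 0 by rewrite /mlin msupp0 big_seq_fset0.
have hN y : mlin h (- y) = - mlin h y.
  by apply/eqP; rewrite -addr_eq0 -mlinD addNr h0.
by move=> x y; rewrite mlinD hN.
Qed.

HB.instance Definition _ h :=
  GRing.isZmodMorphism.Build {malg int[K]} V (mlin h) (mlin_is_zmod_morphism h).

Lemma mlin_sum h1 h2 g : mlin (fun k => h1 k + h2 k) g = mlin h1 g + mlin h2 g.
Proof. by rewrite -big_split; apply: eq_bigr => k _; rewrite mulrzDl. Qed.

Lemma mlinU h k : mlin h << k >> = h k.
Proof. by rewrite (mlinEw h msuppU_le) big_seq_fset1 mcoeffUU mulr1z. Qed.

Lemma malg_intE g : g = \sum_(k <- msupp g) << k >> *~ g@_k.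
Proof.
rewrite [LHS]monalgE; apply: eq_bigr => k _.
by rewrite -{1}(intz g@_k) (raddfMz (mkmalgU k)).
Qed.

Lemma mlin_ext (f1 f2 : {malg int[K]} -> V) :
  zmod_morphism f1 -> zmod_morphism f2 ->
  (forall k, f1 << k >> = f2 << k >>) -> f1 =1 f2.
Proof.
move=> h1 h2 eqf g; rewrite (malg_intE g) (zm_expand h1) (zm_expand h2).
by apply: eq_bigr => k _; rewrite eqf.
Qed.

Lemma bilin_ext (f1 f2 : {malg int[K]} -> {malg int[K]} -> V) :
  (forall y, zmod_morphism (f1^~ y)) -> (forall x, zmod_morphism (f1 x)) ->
  (forall y, zmod_morphism (f2^~ y)) -> (forall x, zmod_morphism (f2 x)) ->
  (forall j k, f1 << j >> << k >> = f2 << j >> << k >>) ->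
  forall x y, f1 x y = f2 x y.
Proof.
move=> l1 r1 l2 r2 eqf x y; rewrite (malg_intE x).
rewrite (zm_expand (l1 y)) (zm_expand (l2 y)).
apply: eq_bigr => j _; congr (_ *~ _); rewrite (malg_intE y).
rewrite (zm_expand (r1 _)) (zm_expand (r2 _)).
by apply: eq_bigr => k _; rewrite eqf.
Qed.

End LinearExtension.

Lemma bilin_assoc (K : choiceType)
    (mul : {malg int[K]} -> {malg int[K]} -> {malg int[K]}) :
  (forall y, zmod_morphism (mul^~ y)) -> (forall x, zmod_morphism (mul x)) ->
  (forall j k l, mul << j >> (mul << k >> << l >>) =
                 mul (mul << j >> << k >>) << l >>) ->
  associative mul.
Proof.
move=> hl hr hA x y z; move: x y.
apply: bilin_ext => [y|x|y|x|j k].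
- by move=> x w; rewrite hl.
- by move=> y w; rewrite hl hr.
- by move=> x w; rewrite !hl.
- by move=> y w; rewrite hr hl.
rewrite (malg_intE z) !(zm_expand (hr _)).
by apply: eq_bigr => l _; rewrite hA.
Qed.

Section PathAlgebra.
Variables (E : finType) (M : matroid E).
Implicit Types (K L : flat M) (s t : seq (flat M)) (p q : flag_path M).
Implicit Types x y z : path_algebra M.

Definition fp_head p := (fp_pair p).1.
Definition fp_tail p := (fp_pair p).2.
Definition fp_last p := last (fp_head p) (fp_tail p).

Lemma pelE p : << p >> = pel (fp_head p) (fp_tail p).
Proof. by rewrite /pel -surjective_pairing valK. Qed.

Lemma pelF K s : path (@adj E M) K s = false -> pel K s = 0.
Proof. by move=> Ks; rewrite /pel insubF. Qed.

Lemma pelT K s : path (@adj E M) K s ->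
  exists p, [/\ pel K s = << p >>, fp_head p = K & fp_tail p = s].
Proof.
by move=> Ks; exists (FlagPath (fp_pair := (K, s)) Ks); rewrite pelE.
Qed.

Definition path_cat p q : path_algebra M :=
  if fp_last p == fp_head q then pel (fp_head p) (fp_tail p ++ fp_tail q)
  else 0.

Definition path_mul x y : path_algebra M :=
  mlin (fun p => mlin (path_cat p) y) x.

Definition path_one : path_algebra M := \sum_(K : flat M) pel K [::].

Lemma path_mulDl : left_distributive path_mul +%R.
Proof. by move=> x y z; apply: mlinD. Qed.

Lemma path_mulDr : right_distributive path_mul +%R.
Proof.
move=> x y z; rewrite /path_mul -mlin_sum.
by apply: eq_bigr => p _; rewrite mlinD.
Qed.

Fact path_mull_morphism y : zmod_morphism (path_mul^~ y).
Proof. by move=> x z; apply: raddfB. Qed.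
Fact path_mulr_morphism x : zmod_morphism (path_mul x).
Proof.
move=> y z; have := path_mulDr x (y - z) z; rewrite subrK => ->.
by rewrite addrK.
Qed.
Let mul0p x : path_mul 0 x = 0. Proof. exact: (zm0 (path_mull_morphism x)). Qed.
Let mulp0 x : path_mul x 0 = 0. Proof. exact: (zm0 (path_mulr_morphism x)). Qed.

Lemma path_mulE K s L t :
  path_mul (pel K s) (pel L t) =
  if last K s == L then pel K (s ++ t) else 0.
Proof.
case Ks: (path (@adj E M) K s); last first.
  rewrite (pelF Ks) (zm0 (path_mull_morphism _)).
  by case: ifP => // _; rewrite pelF // cat_path Ks.
case Lt: (path (@adj E M) L t); last first.
  rewrite (pelF Lt) (zm0 (path_mulr_morphism _)).
  by case: eqP => // KL; rewrite pelF // cat_path Ks KL Lt.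
have [p [-> pK ps]] := pelT Ks; have [q [-> qL qt]] := pelT Lt.
by rewrite /path_mul !mlinU /path_cat /fp_last pK ps qL qt.
Qed.

Lemma path_mulA : associative path_mul.
Proof.
apply: bilin_assoc; [exact: path_mull_morphism|exact: path_mulr_morphism|].
move=> p q r; rewrite !pelE !path_mulE.
transitivity (if (fp_last p == fp_head q) && (fp_last q == fp_head r)
  then pel (fp_head p) (fp_tail p ++ fp_tail q ++ fp_tail r) else 0).
  case: (fp_last q =P _) => qr; last by rewrite mulp0 andbF.
  by rewrite path_mulE andbT.
case: (fp_last p =P _) => pq; last by rewrite mul0p.
by rewrite path_mulE last_cat -/(fp_last p) pq catA.
Qed.

Lemma path_mul1l : left_id path_one path_mul.
Proof.
apply: mlin_ext => // [|p]; first exact: path_mulr_morphism.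
rewrite pelE (zm_sum (path_mull_morphism _)) (bigD1 (fp_head p)) //=.
rewrite path_mulE eqxx big1 ?addr0 // => K neK.
by rewrite path_mulE /= (negPf neK).
Qed.

Lemma path_mul1r : right_id path_one path_mul.
Proof.
apply: mlin_ext => // [|p]; first exact: path_mull_morphism.
rewrite pelE (zm_sum (path_mulr_morphism _)) (bigD1 (fp_last p)) //=.
rewrite path_mulE eqxx cats0 big1 ?addr0 // => K neK.
by rewrite path_mulE eq_sym (negPf neK).
Qed.

Fact flatT_subproof : is_flat M [set: E].
Proof. by apply/forallP=> e; rewrite inE. Qed.
Definition flatT : flat M := Flat flatT_subproof.

(* Sends the one-term flag path (flatT) to 1 and every other flag path to 0;  *)
(* it shows that the algebras below are nonzero.                              *)
Definition top_char : path_algebra M -> int :=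
  mlin (fun p => (fp_pair p == (flatT, [::]))%:R).
HB.instance Definition _ := GRing.Additive.on top_char.

Lemma top_charE K s : top_char (pel K s) = ((K == flatT) && (s == [::]))%:R.
Proof.
case Ks: (path (@adj E M) K s); last first.
  by rewrite (pelF Ks) raddf0; case: eqP Ks => // _; case: eqP => // ->.
have [p [-> pK ps]] := pelT Ks.
by rewrite /top_char mlinU -pK -ps (surjective_pairing (fp_pair p)).
Qed.

Lemma top_charM : {morph top_char : x y / path_mul x y >-> x * y}.
Proof.
apply: (bilin_ext (f1 := fun x y => top_char (path_mul x y))) => [y|x|y|x|p q].
- by move=> x z; rewrite path_mull_morphism raddfB.
- by move=> y z; rewrite path_mulr_morphism raddfB.
- by move=> x z; rewrite raddfB mulrBl.
- by move=> y z; rewrite raddfB mulrBr.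
rewrite !pelE path_mulE !top_charE -natrM mulnb.
case: (fp_tail p) => [|K s] /=; case: (fp_head p =P flatT) => [->|pT] //=.
- by case: eqP => [<-|/eqP/negPf]; rewrite ?top_charE ?eqxx // eq_sym raddf0 => ->.
- by case: eqP; rewrite ?top_charE ?raddf0 // => _; case: eqP pT.
- by case: eqP; rewrite ?top_charE ?raddf0 // andbF.
- by case: eqP; rewrite ?top_charE ?raddf0 // andbF.
Qed.

Lemma top_char1 : top_char path_one = 1.
Proof.
rewrite raddf_sum (bigD1 flatT) //= top_charE !eqxx big1 ?addr0 // => K neK.
by rewrite top_charE (negPf neK).
Qed.

Fact path_one_neq0 : path_one != 0.
Proof. by apply/eqP => /(congr1 top_char); rewrite top_char1 raddf0. Qed.

HB.instance Definition _ := GRing.Zmodule_isNzRing.Build (path_algebra M)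
  path_mulA path_mul1l path_mul1r path_mulDl path_mulDr path_one_neq0.

Lemma pelM K s L t :
  pel K s * pel L t = if last K s == L then pel K (s ++ t) else 0.
Proof. exact: path_mulE. Qed.

Definition path_rev : path_algebra M -> path_algebra M :=
  mlin (fun p => pel (fp_last p) (rev (belast (fp_head p) (fp_tail p)))).
HB.instance Definition _ := GRing.Additive.on path_rev.

Lemma path_revE K s : path_rev (pel K s) = pel (last K s) (rev (belast K s)).
Proof.
case Ks: (path (@adj E M) K s); last first.
  rewrite (pelF Ks) raddf0 pelF // rev_path -{}Ks.
  by apply: eq_path => A B; rewrite adj_sym.
have [p [-> pK ps]] := pelT Ks.
by rewrite /path_rev mlinU /fp_last pK ps.
Qed.

Lemma path_revK : involutive path_rev.
Proof.
apply: mlin_ext => // [|p]; first by move=> x y; rewrite !raddfB.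
rewrite pelE !path_revE; move: (fp_head p) (fp_tail p) => K s.
case: (lastP s) => [|t L] //=.
by rewrite belast_rcons last_rcons rev_cons belast_rcons last_rcons rev_cons revK.
Qed.

Lemma path_revM : {morph path_rev : x y / x * y >-> y * x}.
Proof.
apply: (bilin_ext (f1 := fun x y => path_rev (x * y))
  (f2 := fun x y => path_rev y * path_rev x)) => [y|x|y|x|p q].
- by move=> x z; rewrite mulrBl raddfB.
- by move=> y z; rewrite mulrBr raddfB.
- by move=> x z; rewrite raddfB mulrBr.
- by move=> y z; rewrite raddfB mulrBl.
rewrite !pelE pelM !path_revE pelM.
move: (fp_head p) (fp_tail p) (fp_head q) (fp_tail q) => K s L t.
have -> : last (last L t) (rev (belast L t)) = L.
  by case: t => //= H t; rewrite rev_cons last_rcons.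
rewrite [L == _]eq_sym; case: eqP => [KL|_]; last exact: raddf0.
rewrite path_revE last_cat KL belast_cat rev_cat KL.
by rewrite -rev_cat.
Qed.

End PathAlgebra.

Section SchurAlgebra.
Variables (E : finType) (M : matroid E).
Implicit Types (K L X : flat M) (x y : path_algebra M).

Inductive schur_relation : path_algebra M -> Prop :=
| FS_up L K of (L < K)%O & rho K = (rho L).+2 :
    schur_relation (\sum_(X | covers L X && covers X K) pel L [:: X; K])
| FS_down L K of (L < K)%O & rho K = (rho L).+2 :
    schur_relation (\sum_(X | covers L X && covers X K) pel K [:: X; L])
| Wedge K K' L of covers K L & covers K' L :
    schur_relation
      (pel K [:: L; K'] -
       (if K == K' then pel K [::] *+ #|fset_of L :\: fset_of K|
        else if covers (flatI K K') K then - pel K [:: flatI K K'; K']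
        else 0)).

(* The two-sided ideal generated by schur_relation. *)
Inductive schur_ideal : path_algebra M -> Prop :=
| SI_rel x of schur_relation x : schur_ideal x
| SI_0 : schur_ideal 0
| SI_B x y of schur_ideal x & schur_ideal y : schur_ideal (x - y)
| SI_Ml x y of schur_ideal y : schur_ideal (x * y)
| SI_Mr x y of schur_ideal x : schur_ideal (x * y).

Definition in_schur_ideal : {pred path_algebra M} :=
  fun x => boolp.asbool (schur_ideal x).

Lemma schur_idealP x : reflect (schur_ideal x) (x \in in_schur_ideal).
Proof. exact: boolp.asboolP. Qed.

Fact schur_ideal_zmod_closed : zmod_closed in_schur_ideal.
Proof.
split=> [|x y /schur_idealP Ix /schur_idealP Iy]; apply/schur_idealP.
  exact: SI_0.
exact: SI_B.
Qed.
HB.instance Definition _ := GRing.isZmodClosed.Build (path_algebra M)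
  in_schur_ideal schur_ideal_zmod_closed.

Definition schur_algebra : Type := Quotient.quot in_schur_ideal.
HB.instance Definition _ := GRing.Zmodule.on schur_algebra.
Implicit Types a b c : schur_algebra.

Definition to_schur x : schur_algebra := \pi_(Quotient.quot in_schur_ideal) x.

Fact to_schur_is_zmod_morphism : zmod_morphism to_schur.
Proof. by move=> x y; rewrite /to_schur raddfB. Qed.
HB.instance Definition _ := GRing.isZmodMorphism.Build
  (path_algebra M) schur_algebra to_schur to_schur_is_zmod_morphism.

Lemma to_schur_eqP x y : reflect (schur_ideal (x - y)) (to_schur x == to_schur y).
Proof.
by rewrite -(Quotient.idealrBE in_schur_ideal); apply: schur_idealP.
Qed.

Lemma to_schur_reprK a : to_schur (repr a) = a.
Proof. exact: reprK. Qed.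

Lemma schur_ideal_repr x : schur_ideal (repr (to_schur x) - x).
Proof. by apply/to_schur_eqP; rewrite to_schur_reprK. Qed.

Lemma schur_ideal_ext (f : path_algebra M -> path_algebra M) x :
  zmod_morphism f -> (forall y, schur_ideal y -> schur_ideal (f y)) ->
  to_schur (f (repr (to_schur x))) = to_schur (f x).
Proof.
move=> hf hI; apply/eqP/to_schur_eqP; rewrite -hf.
exact/hI/schur_ideal_repr.
Qed.

Definition schur_mul a b : schur_algebra := to_schur (repr a * repr b).

Lemma to_schurM : {morph to_schur : x y / x * y >-> schur_mul x y}.
Proof.
move=> x y; symmetry; transitivity (to_schur (x * repr (to_schur y))).
  apply: (schur_ideal_ext (f := *%R^~ (repr (to_schur y)))).
    by move=> z t; rewrite mulrBl.
  by move=> z; apply: SI_Mr.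
apply: (schur_ideal_ext (f := *%R x)); first by move=> z t; rewrite mulrBr.
by move=> z; apply: SI_Ml.
Qed.

Fact schur_mulA : associative schur_mul.
Proof.
move=> a b c; rewrite -(to_schur_reprK a) -(to_schur_reprK b).
by rewrite -(to_schur_reprK c) -!to_schurM mulrA.
Qed.

Fact schur_mul1l : left_id (to_schur 1) schur_mul.
Proof. by move=> a; rewrite -(to_schur_reprK a) -to_schurM mul1r. Qed.

Fact schur_mul1r : right_id (to_schur 1) schur_mul.
Proof. by move=> a; rewrite -(to_schur_reprK a) -to_schurM mulr1. Qed.

Fact schur_mulDl : left_distributive schur_mul +%R.
Proof.
move=> a b c; rewrite -(to_schur_reprK a) -(to_schur_reprK b).
by rewrite -(to_schur_reprK c) -raddfD -!to_schurM mulrDl raddfD.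
Qed.

Fact schur_mulDr : right_distributive schur_mul +%R.
Proof.
move=> a b c; rewrite -(to_schur_reprK a) -(to_schur_reprK b).
by rewrite -(to_schur_reprK c) -raddfD -!to_schurM mulrDr raddfD.
Qed.

Lemma schur_ideal_top_char x : schur_ideal x -> top_char x = 0.
Proof.
elim=> {x} [x [L K _ _|L K _ _|K K' L KL K'L]||x y _ x0 _ y0|x y _ y0|x y _ x0].
- by rewrite raddf_sum big1 // => X _; rewrite /= top_charE andbF.
- by rewrite raddf_sum big1 // => X _; rewrite /= top_charE andbF.
- rewrite raddfB /= top_charE andbF sub0r; apply/eqP; rewrite oppr_eq0.
  case: (K =P K') => [_|_]; last first.
    by case: ifP; rewrite ?raddf0 // raddfN /= top_charE andbF oppr0.
  rewrite raddfMn /= top_charE; case: (K =P _) KL => [->|_]; last by rewrite mul0rn.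
  by case/andP; rewrite flat_ltE properE subsetT andbF.
- exact: raddf0.
- by rewrite raddfB /= x0 y0 subrr.
- by rewrite [LHS]top_charM y0 mulr0.
- by rewrite [LHS]top_charM x0 mul0r.
Qed.

Fact schur_one_neq0 : to_schur 1 != 0.
Proof.
rewrite -(raddf0 to_schur); apply/to_schur_eqP; rewrite subr0.
by move=> /schur_ideal_top_char; rewrite [LHS](top_char1 M).
Qed.

HB.instance Definition _ := GRing.Zmodule_isNzRing.Build schur_algebra
  schur_mulA schur_mul1l schur_mul1r schur_mulDl schur_mulDr schur_one_neq0.

Fact to_schur_is_monoid_morphism : monoid_morphism to_schur.
Proof. by split; last exact: to_schurM. Qed.
HB.instance Definition _ := GRing.isMonoidMorphism.Build
  (path_algebra M) schur_algebra to_schur to_schur_is_monoid_morphism.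

Definition schur_scale (n : int) a : schur_algebra := a *~ n.

Fact schur_scaleA m n a :
  schur_scale m (schur_scale n a) = schur_scale (m * n) a.
Proof. by rewrite /schur_scale -mulrzA mulrC. Qed.
Fact schur_scale1 : left_id 1 schur_scale.
Proof. by move=> a; apply: mulr1z. Qed.
Fact schur_scaleDr : right_distributive schur_scale +%R.
Proof. by move=> n a b; apply: mulrzDl. Qed.
Fact schur_scaleDl a : {morph schur_scale^~ a : m n / m + n}.
Proof. by move=> m n; apply: mulrzDr. Qed.

HB.instance Definition _ := GRing.Zmodule_isLmodule.Build int schur_algebra
  schur_scaleA schur_scale1 schur_scaleDr schur_scaleDl.

Fact schur_scaleAl (n : int) a b : n *: (a * b) = (n *: a) * b.
Proof. exact/esym/mulrzAl. Qed.
HB.instance Definition _ := GRing.Lmodule_isLalgebra.Build int schur_algebra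
  schur_scaleAl.

Fact schur_scaleAr (n : int) a b : n *: (a * b) = a * (n *: b).
Proof. exact/esym/mulrzAr. Qed.
HB.instance Definition _ := GRing.Lalgebra_isAlgebra.Build int schur_algebra
  schur_scaleAr.

Lemma flatIC K L : flatI K L = flatI L K.
Proof. by apply: val_inj; apply: setIC. Qed.

Lemma covers_flatI K K' L :
  covers K L -> covers K' L -> covers (flatI K K') K = covers (flatI K K') K'.
Proof.
have half A B : covers A L -> covers B L ->
    covers (flatI A B) A -> covers (flatI A B) B.
  move=> /coversP[_ rA] /coversP[_ rB] /coversP[_ rAB].
  have eqr : rho A = rho B by move: rA; rewrite rB => -[].
  apply/coversP; split; last by rewrite -eqr.
  rewrite lt_neqAle flat_leE subsetIr andbT.
  by apply/eqP=> eqB; move: rAB; rewrite eqB eqr => /eqP; elim: (rho B).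
move=> KL K'L; apply/idP/idP; first exact: half.
by rewrite flatIC; apply: half.
Qed.

Lemma schur_ideal_rev x : schur_ideal x -> schur_ideal (path_rev x).
Proof.
elim=> {x} [x [L K LK r|L K LK r|K K' L KL K'L]||x y _ x0 _ y0|x y _ y0|x y _ x0].
- rewrite raddf_sum /=.
  under eq_bigr do rewrite path_revE /=.
  exact/SI_rel/FS_down.
- rewrite raddf_sum /=.
  under eq_bigr do rewrite path_revE /=.
  exact/SI_rel/FS_up.
- have := SI_rel (Wedge K'L KL); rewrite eq_sym flatIC.
  rewrite raddfB /= path_revE /= -(covers_flatI KL K'L).
  case: (K =P K') => [->|_].
    by rewrite [path_rev (_ *+ _)]raddfMn /= path_revE.
  case: ifP => _; last by rewrite [path_rev 0]raddf0.
  by rewrite [path_rev (- _)]raddfN /= path_revE.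
- by rewrite raddf0; apply: SI_0.
- by rewrite raddfB; apply: SI_B.
- by rewrite path_revM; apply: SI_Mr.
- by rewrite path_revM; apply: SI_Ml.
Qed.

Definition schur_iota (a : schur_algebra) : schur_algebra :=
  to_schur (path_rev (repr a)).

Lemma schur_iotaE x : schur_iota (to_schur x) = to_schur (path_rev x).
Proof.
by apply: schur_ideal_ext; [move=> y z; rewrite raddfB|apply: schur_ideal_rev].
Qed.

End SchurAlgebra.

Arguments schur_algebra {E} M.

Section NeatFlags.
Variables (E : finType) (M : matroid E).
Implicit Types (K L X Y : flat M) (p : flag_path M).

(* For each base flat K, the map ell K labels the flats L > K by elements of  *)
(* L \ K, that is, it labels the nonempty flats of the contraction M / K; for  *)
(* a total order on E one may take the least element of L \ K. A labelling of  *)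
(* the flats L that ignores K is not enough: if K < L and the label of L lies *)
(* in K, then no flag from L down to K is neat, and the elements C^K_FG below *)
(* fail to span.                                                              *)
Definition labelling (ell : flat M -> flat M -> E) : Prop :=
  forall K L, (K < L)%O -> ell K L \in fset_of L :\: fset_of K.

Variable ell : flat M -> flat M -> E.

Definition neat_step K X Y : bool :=
  covers Y X && (ell K X \in fset_of X :\: fset_of Y).

(* The flag (K_k, .., K_1, K) is listed from its largest flat down to K. *)
Definition neat K p : bool :=
  (fp_last p == K) && path (neat_step K) (fp_head p) (fp_tail p).

Record neat_flag K := NeatFlag { nf_path :> flag_path M; _ : neat K nf_path }.

HB.instance Definition _ K := [isSub for @nf_path K].
HB.instance Definition _ K := [Countable of neat_flag K by <:].

Definition enum_neat_flag K : seq (neat_flag K) :=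
  pmap insub (pmap insub
    [seq (w.1, val w.2) | w <- enum {: flat M * #|{: flat M}|.-bseq (flat M)}]).

Lemma size_neat K p : neat K p -> (size (fp_tail p) <= #|{: flat M}|)%N.
Proof.
case/andP=> _ pp; have : uniq (fp_head p :: fp_tail p).
  apply: (@sorted_uniq _ (fun X Y => (Y < X)%O)).
  - by move=> X Y Z XY ZX; apply: lt_trans ZX XY.
  - by move=> X; apply: ltxx.
  - by apply: sub_path pp => X Y /andP[/andP[]].
move=> /card_uniqP/esym eqc; apply: ltnW; by rewrite -/(size (fp_head p :: fp_tail p)) eqc max_card.
Qed.

Fact enum_neat_flag_subproof K : Finite.axiom (enum_neat_flag K).
Proof.
apply: Finite.uniq_enumP.
  do 2!apply: pmap_sub_uniq; rewrite map_inj_uniq ?enum_uniq //.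
  by move=> [X s] [Y t] [-> /val_inj ->].
move=> p; rewrite mem_pmap_sub mem_pmap_sub inE; apply/mapP.
have sp := size_neat (valP p).
by exists (fp_head (val p), Bseq sp); rewrite ?mem_enum //= -surjective_pairing.
Qed.

HB.instance Definition _ K :=
  isFinite.Build (neat_flag K) (@enum_neat_flag_subproof K).

Definition cell_elt K (F G : neat_flag K) : schur_algebra M :=
  to_schur << nf_path F >> * schur_iota (to_schur << nf_path G >>).

Lemma cell_eltE K (F G : neat_flag K) :
  cell_elt F G =
  to_schur (pel (fp_head F)
    (fp_tail F ++ rev (belast (fp_head G) (fp_tail G)))).
Proof.
have /andP[/eqP FK _] := valP F; have /andP[/eqP GK _] := valP G.
rewrite /cell_elt schur_iotaE -rmorphM !pelE path_revE.
by rewrite pelM -/(fp_last F) FK -/(fp_last G) GK eqxx.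
Qed.

End NeatFlags.

Section CellDatum.
(* That R is Noetherian is not recorded: R is only used at int. *)
Variables (R : idomainType) (A : algType R).
Variables (d : Order.disp_t) (Lam : finPOrderType d) (N : Lam -> finType).
Variables (C : forall lam, N lam -> N lam -> A) (i : A -> A).

Definition cell_comb (P : pred Lam) (c : forall mu, N mu -> N mu -> R) : A :=
  \sum_(mu | P mu) \sum_(S : N mu) \sum_(T : N mu) c mu S T *: C S T.

Record cell_datum : Prop := CellDatum {
  cell_nonempty : forall lam, (0 < #|N lam|)%N;
  cell_linear : linear i;
  cell_antimult : forall a b, i (a * b) = i b * i a;
  cell_involutive : involutive i;
  cell_span : forall a, exists c, a = cell_comb predT c;
  cell_free : forall c, cell_comb predT c = 0 -> forall mu S T, c mu S T = 0;
  cell_anti : forall lam (S T : N lam), i (C S T) = C T S;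
  cell_mul : forall lam (a : A), exists r : N lam -> N lam -> R,
    forall S T : N lam, exists c,
    a * C S T = \sum_(U : N lam) r U S *: C U T
                + cell_comb (fun mu => (mu < lam)%O) c }.

End CellDatum.

(* Main.v *)
(* Spanning.  The relations (/\) push an up-step to the right through a down   *)
(* flag, and (FS) makes a down flag from X to K a combination of neat ones:   *)
(* for e in X \ K one can reach flags whose second flat avoids e.  Hence the  *)
(* left action is triangular on the C^K_FG, and a = a * 1 is in their span.   *)
(* Freeness.  For each flat B the path algebra acts on exterior powers: a     *)
(* down-step (K > L) wedges with the indicator vector 1_(K \ L), and an       *)
(* up-step (K < L) contracts with 1_(L \ K) and restricts to K, or is 0 if    *)
(* K does not contain B.  On vectors supported on tuples that complete B to a *)
(* spanning set of the current flat, (/\) is the Clifford relation and (FS)   *)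
(* is v /\ v = 0.  Contracting along a neat flag G the wedge of the points    *)
(* ell B H_i of a neat flag H gives [G = H], and so does evaluating at these  *)
(* points the wedge of the vectors 1_(G_i \ G_(i-1)); taking B maximal among  *)
(* the flats occurring in a linear relation isolates each coefficient.        *)
Require Import Defs.
From mathcomp Require Import all_boot all_order all_algebra.
From mathcomp Require Import finmap monalg.
From mathcomp Require boolp.

Set Implicit Arguments.
Unset Strict Implicit.
Unset Printing Implicit Defensive.

Import Order.TTheory GRing.Theory Num.Theory.
Local Open Scope ring_scope.

(** Spanning rests on a partition: for flats L < K two ranks apart, the sets X \ L with X strictly
    between them partition K \ L ([between_exists], [covers_common]). So (FS), applied from the foot
    of a down flag upwards, trades a second flat containing a given point for flats avoiding it;
    with the point [ell K X] this produces neat flags ([neat_reduce]). An up-step in front of a down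
    flag is carried to its foot K by (/\) ([up_downflag]); if it survives there, it starts at some A
    < K and lands in a smaller cell. This is axiom (3) for one-step paths ([cellular_step]);
    products preserve it ([cellularM]), and applying it to 1 gives spanning ([in_cells_all]).

    Freeness uses a fermionic Fock representation for each flat B: down-steps create, up-steps
    annihilate. The Clifford relation [contract_wedge] accounts for (/\), the vanishing of squares
    for (FS), and [schur_ideal_Act] concludes that S(M) acts. With base K, neat flags have dual
    vectors, against which cell K evaluates to Kronecker deltas ([Act_lift]), while cells not above
    K act as zero ([Act_lift_out]). Descending induction on rank then kills every coefficient
    ([cell_comb_free]). *)

Definition zmod_pred (V : zmodType) (P : V -> Prop) : Prop :=
  P 0 /\ forall x y, P x -> P y -> P (x - y).

Section ZmodPred.
Variables (V : zmodType) (P : V -> Prop) (hP : zmod_pred P).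

Lemma zmod_predN x : P x -> P (- x).
Proof. by case: hP => P0 PB Px; rewrite -sub0r; apply: PB. Qed.

Lemma zmod_predD x y : P x -> P y -> P (x + y).
Proof. by move=> Px /zmod_predN Py; rewrite -[y]opprK; apply: hP.2. Qed.

Lemma zmod_pred_sum (I : Type) (r : seq I) (Q : pred I) (F : I -> V) :
  (forall i, Q i -> P (F i)) -> P (\sum_(i <- r | Q i) F i).
Proof. by move=> PF; apply: big_ind => //; [exact: hP.1|exact: zmod_predD]. Qed.

Lemma zmod_predMn x n : P x -> P (x *+ n).
Proof.
move=> Px; elim: n => [|n IH]; first exact: hP.1.
by rewrite mulrS; apply: zmod_predD.
Qed.

Lemma zmod_predMz x (n : int) : P x -> P (x *~ n).
Proof.
by move=> Px; case: n => n; [|apply: zmod_predN]; apply: zmod_predMn.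
Qed.

(** Pulling back along multiplication by a fixed factor lets the straightening inductions work on
    one part of a path. *)
Lemma zmod_pred_comp (W : zmodType) (f : W -> V) :
  zmod_morphism f -> zmod_pred (fun x => P (f x)).
Proof.
move=> hf; split=> [|x y Px Py]; first by rewrite (zm0 hf); apply: hP.1.
by rewrite hf; apply: hP.2.
Qed.

End ZmodPred.

Lemma malg_ind (K : choiceType) (P : {malg int[K]} -> Prop) :
  zmod_pred P -> (forall k, P << k >>) -> forall x, P x.
Proof.
move=> hP Pk x; rewrite (malg_intE x).
by apply: zmod_pred_sum => // k _; apply: zmod_predMz.
Qed.

(** * Closures and covers in the lattice of flats *)

Section Closure.
Variables (E : finType) (M : matroid E).
Implicit Types (A B : {set E}) (K L X Y : flat M).

(** A maximal superset of [A] of the same rank is a flat, since any further point must raise its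
    rank. *)
Lemma exists_closure A : exists X : flat M, A \subset X /\ rho X = rk M A.
Proof.
pose P B := (A \subset B) && (rk M B == rk M A).
have [B /maxsetP[/andP[AB /eqP rB] maxB] _] : {B | maxset P B & A \subset B}.
  by apply: maxset_exists; rewrite /P subxx eqxx.
have flB : is_flat M B.
  apply/forallP=> y; apply/implyP=> yB; rewrite ltn_neqAle rk_mono ?subsetUr //.
  rewrite andbT; apply: contra yB => /eqP eqB.
  rewrite -(maxB (y |: B)) ?subsetUr ?setU11 // /P -eqB rB eqxx andbT.
  exact: subset_trans AB (subsetUr _ _).
by exists (Flat flB).
Qed.

Lemma rkU1_le x A : (rk M (x |: A) <= (rk M A).+1)%N.
Proof.
have := rk_submod M [set x] A; have := rk_card M [set x]; rewrite cards1.
move=> r1 r2; rewrite -add1n.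
by apply: leq_trans (leq_trans (leq_addr _ _) r2) _; rewrite leq_add2r.
Qed.

(** [A] spans [K], and submodularity for [x |: A] and [K] transfers to [A] the rank jump that [x]
    causes over [K]. *)
Lemma rkU1_gt K x A : x \notin fset_of K -> A \subset K -> (rho K <= rk M A)%N ->
  (rk M A < rk M (x |: A))%N.
Proof.
move=> xK AK rA; have := forallP (valP K) x; rewrite xK /= => rxK.
have := rk_submod M (x |: A) K; rewrite -setUA (setUidPr AK) => sub.
have rA' : (rk M A <= rk M ((x |: A) :&: K))%N.
  by apply: rk_mono; rewrite subsetI AK subsetUr.
have h := leq_trans (leq_add rxK rA') sub.
rewrite -(ltn_add2r (rho K)); apply: leq_trans h.
by rewrite addSn ltnS addnC leq_add2l.
Qed.

Lemma covers_lt K L : covers K L -> (K < L)%O.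
Proof. by case/andP. Qed.

Lemma flat_lt_sub K L : (K < L)%O -> fset_of K \subset L.
Proof. by rewrite flat_ltE => /andP[]. Qed.

Lemma covers_sub K L : covers K L -> fset_of K \subset L.
Proof. by move/covers_lt/flat_lt_sub. Qed.

Lemma covers_rho K L : covers K L -> rho L = (rho K).+1.
Proof. by case/coversP. Qed.

Lemma flat_rho_le K L : (K <= L)%O -> (rho K <= rho L)%N.
Proof. exact: rk_mono. Qed.

Lemma flat_rho_eq K L : (K <= L)%O -> (rho L <= rho K)%N -> K = L.
Proof.
rewrite le_eqVlt => /orP[/eqP //|/flat_lt_rho]; by rewrite ltnNge => /negPf->.
Qed.

(** The witness is a closure of [x |: L] cut down by [K], which puts it below [K] while its rank
    stays one above that of [L]. *)
Lemma between_exists L K x : (L < K)%O -> rho K = (rho L).+2 ->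
  x \in fset_of K :\: L ->
  exists X, [/\ covers L X, covers X K & x \in fset_of X].
Proof.
move=> LK rK; rewrite inE => /andP[xL xK].
have [Z [sZ rZ]] := exists_closure (x |: L); pose X := flatI Z K.
have xX : x \in fset_of X by rewrite inE xK (subsetP sZ) ?setU11.
have LX : (L < X)%O.
  rewrite flat_ltE; apply/properP; split; last by exists x.
  by rewrite subsetI (flat_lt_sub LK) (subset_trans _ sZ) ?subsetUr.
have XK : (X <= K)%O by apply: subsetIr.
have rX : rho X = (rho L).+1.
  apply/eqP; rewrite eqn_leq flat_lt_rho // andbT.
  rewrite (leq_trans (flat_rho_le (subsetIl _ _ : X <= Z)%O)) // rZ.
  exact: rkU1_le.
exists X; split=> //; apply/coversP; split=> //; last by rewrite rX.
rewrite lt_neqAle XK andbT; apply: contra_eq_neq rK => <-.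
by rewrite rX neq_ltn ltnSn.
Qed.

(** The intersection of [X] and [Y] contains [x], so it lies strictly above [L] and already has the
    rank of each cover. *)
Lemma covers_common L X Y x : covers L X -> covers L Y -> x \notin fset_of L ->
  x \in fset_of X -> x \in fset_of Y -> X = Y.
Proof.
have half (A B : flat M) : covers L A -> covers L B -> x \notin fset_of L ->
    x \in fset_of A -> x \in fset_of B -> (A <= B)%O.
  move=> /[dup] LA /covers_sub sA /covers_sub sB xL xA xB.
  have LI : (L < flatI A B)%O.
    rewrite flat_ltE; apply/properP; split; first by rewrite subsetI sA.
    by exists x => //; rewrite inE xA.
  have := flat_lt_rho LI; rewrite -(covers_rho LA).
  by move/(flat_rho_eq (subsetIl _ _ : flatI A B <= A)%O) => <-; apply: subsetIr.
by move=> LX LY xL xX xY; apply/le_anti; rewrite !half.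
Qed.

End Closure.

(** * Straightening flag paths *)

Section Straightening.
Variables (E : finType) (M : matroid E) (ell : flat M -> flat M -> E).
Implicit Types (K L A X Y Z : flat M) (s t : seq (flat M)).
Implicit Types (P : schur_algebra M -> Prop).

Definition spath K s : schur_algebra M := to_schur (pel K s).

Lemma spathM K s L t :
  spath K s * spath L t = if last K s == L then spath K (s ++ t) else 0.
Proof.
by rewrite /spath -rmorphM pelM; case: ifP => // _; rewrite raddf0.
Qed.

Lemma spath_cons K L s : spath K (L :: s) = spath K [:: L] * spath L s.
Proof. by rewrite spathM eqxx. Qed.

Lemma spath_iota K s : schur_iota (spath K s) = spath (last K s) (rev (belast K s)).
Proof. by rewrite /spath schur_iotaE path_revE. Qed.

Lemma to_schur_ideal (x : path_algebra M) : schur_ideal x -> to_schur x = 0.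
Proof.
by move=> Ix; rewrite -(raddf0 (@to_schur E M)); apply/eqP/to_schur_eqP; rewrite subr0.
Qed.

Lemma spath_FS L K : (L < K)%O -> rho K = (rho L).+2 ->
  \sum_(X | covers L X && covers X K) spath K [:: X; L] = 0.
Proof.
by move=> LK rK; rewrite -raddf_sum; apply/to_schur_ideal/SI_rel/FS_down.
Qed.

Lemma spath_wedge K K' L : covers K L -> covers K' L ->
  spath K [:: L; K'] =
    if K == K' then spath K [::] *+ #|fset_of L :\: fset_of K|
    else if covers (flatI K K') K then - spath K [:: flatI K K'; K'] else 0.
Proof.
move=> KL K'L; have := to_schur_ideal (SI_rel (Wedge KL K'L)).
rewrite raddfB => /subr0_eq; rewrite /spath /= => ->.
case: ifP => _; first exact: raddfMn.
by case: ifP => _; [exact: raddfN | exact: raddf0].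
Qed.

Definition down : rel (flat M) := fun X Y => covers Y X.

Definition downflag K X s : bool := path down X s && (last X s == K).

Lemma downflag_le K X s : downflag K X s -> (K <= X)%O.
Proof.
elim: s X => [|Y s IH] X; first by move/eqP<-.
by case/andP=> /andP[/covers_lt/ltW YX p] l; apply: le_trans YX; apply: IH; apply/andP.
Qed.

Lemma downflag_cons K X Y s : downflag K X (Y :: s) = covers Y X && downflag K Y s.
Proof. by rewrite /downflag /= andbA. Qed.

(* By induction the third flat Z already avoids e, so in (FS) on X > Z all
   terms but the one through Y avoid e. *)
Lemma downflag_avoid K X Y s e P : zmod_pred P ->
  downflag K X (Y :: s) -> e \in fset_of X :\: K ->
  (forall Y' s', e \notin fset_of Y' -> downflag K X (Y' :: s') ->
     size s' = size s -> P (spath X (Y' :: s'))) ->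
  P (spath X (Y :: s)).
Proof.
elim: s X Y P => [|Z s IH] X Y P hP dXY; rewrite inE => /andP[eK eX] PY.
  apply: PY => //; move: dXY; rewrite downflag_cons => /andP[_ /andP[_ /eqP /= ->]].
  exact: eK.
have [eY|eY] := boolP (e \in fset_of Y); last exact: PY.
move: dXY; rewrite downflag_cons => /andP[YX dY]; rewrite spath_cons.
pose P' x := P (spath X [:: Y] * x).
have hP' : zmod_pred P'.
  by apply: zmod_pred_comp => // x y; rewrite mulrBr.
apply: (IH Y Z P') => // [|Z' t eZ]; first by rewrite inE eK.
rewrite downflag_cons => /andP[Z'Y dZ'] st.
have Z'X : (Z' < X)%O by apply: lt_trans (covers_lt Z'Y) (covers_lt YX).
have rX : rho X = (rho Z').+2 by rewrite (covers_rho YX) (covers_rho Z'Y).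
rewrite /P' -spath_cons.
have -> : spath X [:: Y, Z' & t] = spath X [:: Y; Z'] * spath Z' t.
  by rewrite spathM eqxx.
have /eqP := spath_FS Z'X rX; rewrite (bigD1 Y) /=; last by rewrite Z'Y.
rewrite addr_eq0 => /eqP->; rewrite mulNr mulr_suml; apply: zmod_predN => //.
apply: zmod_pred_sum => // Y' /andP[/andP[Z'Y' Y'X] neY].
rewrite spathM eqxx; apply: PY => /=; last by rewrite st.
  by apply: contra neY => eY'; rewrite (covers_common Z'Y' Z'Y eZ).
by rewrite !downflag_cons Y'X Z'Y'.
Qed.

(** A first step is neat when the second flat misses [ell K X], which [downflag_avoid] arranges; the
    shorter tail is handled by induction under the fixed first step. The conclusion is stated for an
    arbitrary subgroup [P], so that it serves for left factors, right factors and rows alike. *)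
Lemma neat_reduce (hell : labelling ell) K X s P : zmod_pred P ->
  downflag K X s ->
  (forall U : neat_flag ell K, fp_head U = X -> P (to_schur << nf_path U >>)) ->
  P (spath X s).
Proof.
move=> hP dX PU.
(* Restated for lists, the hypothesis allows flats to be prepended without rebuilding a
   [neat_flag]. *)
have {}PU t : last X t = K -> path (neat_step ell K) X t -> P (spath X t).
  move=> lt pt; have at_ : path (@adj E M) X t.
    by apply: sub_path pt => Y Z /andP[c _]; rewrite /adj c orbT.
  have [p [ep ph pt']] := pelT at_.
  have np : neat ell K p by rewrite /neat /fp_last ph pt' lt eqxx.
  by rewrite /spath ep; apply: (PU (NeatFlag np)).
elim: {s}(size s) {-2}s (leqnn (size s)) X P hP dX PU =>
    [|n IH] [|Y s] //= sn X P hP dX PU.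
- by apply: PU => //; case/andP: dX => _ /eqP.
- by apply: PU => //; case/andP: dX => _ /eqP.
have KX : (K < X)%O.
  move: dX; rewrite downflag_cons => /andP[/covers_lt YX /downflag_le KY].
  exact: le_lt_trans YX.
apply: (downflag_avoid (e := ell K X) hP dX (hell _ _ KX)) => Z t eZ dt st.
move: dt; rewrite downflag_cons spath_cons => /andP[ZX dZ].
apply: (IH t _ Z (fun x => P (spath X [:: Z] * x))) => //.
- by rewrite st.
- by apply: zmod_pred_comp => // x y; rewrite mulrBr.
move=> u lu pu; rewrite -spath_cons; apply: PU => //=.
rewrite pu andbT /neat_step ZX inE eZ.
by have := hell _ _ KX; rewrite inE => /andP[_ ->].
Qed.

(** At each down-step, (/\) either absorbs the up-step into a scalar, kills the path, or moves the
    up-step one place to the right with a sign. The two hypotheses on [P] cover absorption on the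
    way and survival as a last step from [A] up to [K]. *)
Lemma up_downflag K X X' s P : zmod_pred P -> downflag K X s -> covers X' X ->
  (forall s', downflag K X' s' -> P (spath X' s')) ->
  (forall A s', covers A K -> downflag A X' s' ->
     P (spath X' s' * spath A [:: K])) ->
  P (spath X' [:: X] * spath X s).
Proof.
elim: s X X' P => [|Y s IH] X X' P hP dX X'X PK PA.
  have XK : X = K by case/andP: dX => _ /eqP.
  have := PA X' [::]; rewrite spathM eqxx XK spathM eqxx cats0 /=; apply.
    by rewrite -XK.
  exact: eqxx.
move: dX; rewrite downflag_cons => /andP[YX dY].
rewrite (spath_cons X Y) mulrA spathM eqxx spath_wedge //.
case: (X' =P Y) => [eY|/eqP neY].
  rewrite -eY in dY *.
  rewrite mulrnAl; apply: zmod_predMn => //; rewrite spathM eqxx.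
  exact: PK.
case: ifP => IX'; last by rewrite mul0r; apply: hP.1.
rewrite mulNr; apply: zmod_predN => //.
rewrite (spath_cons X') -mulrA.
apply: (IH _ _ (fun x => P (spath X' [:: flatI X' Y] * x))) => //.
- by apply: zmod_pred_comp => // x y; rewrite mulrBr.
- by rewrite -(covers_flatI X'X YX).
- by move=> t dt; rewrite -spath_cons; apply: PK; rewrite downflag_cons IX'.
- by move=> A t AK dt; rewrite mulrA -spath_cons; apply: PA; rewrite // downflag_cons IX'.
Qed.

End Straightening.

(** * Combinations of cell elements *)

Section CellComb.
Variables (R : idomainType) (A : algType R).
Variables (d : Order.disp_t) (Lam : finPOrderType d) (N : Lam -> finType).
Variables (C : forall lam, N lam -> N lam -> A).
Implicit Types (P : pred Lam) (lam mu : Lam) (a x : A).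

Definition in_cells P x : Prop := exists c, x = cell_comb C P c.

Lemma in_cells_zmod P : zmod_pred (in_cells P).
Proof.
split=> [|x y [c ->] [c' ->]].
  exists (fun _ _ _ => 0); rewrite /cell_comb.
  rewrite big1 // => mu _; rewrite big1 // => S _.
  by rewrite big1 // => T _; rewrite scale0r.
exists (fun mu S T => c mu S T - c' mu S T); rewrite /cell_comb -sumrB.
apply: eq_bigr => mu _; rewrite -sumrB; apply: eq_bigr => S _; rewrite -sumrB.
by apply: eq_bigr => T _; rewrite scalerBl.
Qed.

Lemma in_cellsZ P k x : in_cells P x -> in_cells P (k *: x).
Proof.
move=> [c ->]; exists (fun mu S T => k * c mu S T); rewrite /cell_comb scaler_sumr.
apply: eq_bigr => mu _; rewrite scaler_sumr; apply: eq_bigr => S _.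
by rewrite scaler_sumr; apply: eq_bigr => T _; rewrite scalerA.
Qed.

Lemma in_cells_elt P lam (S T : N lam) : P lam -> in_cells P (C S T).
Proof.
move=> Plam; pose NN mu := (N mu * N mu)%type.
(* The index types depend on [mu], so the pairs are compared as tagged pairs. *)
exists (fun mu S' T' => (Tagged NN (S', T') == Tagged NN (S, T))%:R).
rewrite /cell_comb (bigD1 lam) //= (bigD1 S) //= (bigD1 T) //= eqxx scale1r.
rewrite !big1 ?addr0 // => [mu /andP[_ ne]|S' ne|T' ne].
- rewrite big1 // => S' _; rewrite big1 // => T' _.
  by rewrite -tag_eqE /tag_eq /= (negPf ne) scale0r.
- by rewrite big1 // => T' _; rewrite eq_Tagged xpair_eqE /= (negPf ne) scale0r.
- by rewrite eq_Tagged /= xpair_eqE (negPf ne) andbF scale0r.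
Qed.

Lemma in_cells_sub P P' x : (forall lam, P lam -> P' lam) ->
  in_cells P x -> in_cells P' x.
Proof.
move=> PP' [c ->]; have hP' := in_cells_zmod P'.
apply: zmod_pred_sum => // mu /PP' P'mu; apply: zmod_pred_sum => // S _.
by apply: zmod_pred_sum => // T _; apply/in_cellsZ/in_cells_elt.
Qed.

(* Axiom (3) of a cellular algebra for the family y T = a C_(S,T). *)
Definition cell_row lam (y : N lam -> A) : Prop := exists r : N lam -> R,
  forall T, in_cells (fun mu => (mu < lam)%O) (y T - \sum_U r U *: C U T).

Lemma cell_row_low lam (y : N lam -> A) :
  (forall T, in_cells (fun mu => (mu < lam)%O) (y T)) -> cell_row y.
Proof.
move=> hy; exists (fun _ => 0) => T; rewrite big1 ?subr0 // => U _.
by rewrite scale0r.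
Qed.

Lemma cell_row_elt lam (S : N lam) : cell_row (C S).
Proof.
exists (fun U => (U == S)%:R) => T; rewrite (bigD1 S) //= eqxx scale1r.
rewrite big1 ?addr0 ?subrr; first exact: (in_cells_zmod _).1.
by move=> U /negPf->; rewrite scale0r.
Qed.

Lemma cell_rowB lam (y z : N lam -> A) :
  cell_row y -> cell_row z -> cell_row (fun T => y T - z T).
Proof.
move=> [r hr] [r' hr']; exists (fun U => r U - r' U) => T.
have := (in_cells_zmod _).2 _ _ (hr T) (hr' T).
under [in X in _ -> X]eq_bigr do rewrite scalerBl.
by rewrite sumrB !opprB addrACA [X in _ -> _ X]addrACA [- _ - \sum_(i | _) _ *: _]addrC.
Qed.

(** These elements form an additive subgroup closed under products, so one-step and trivial paths
    suffice. *)
Definition cellular a : Prop := forall lam (S : N lam), cell_row (fun T => a * C S T).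

Lemma cellular_zmod : zmod_pred cellular.
Proof.
split=> [lam S|a b ha hb lam S].
  by apply: cell_row_low => T; rewrite mul0r; apply: (in_cells_zmod _).1.
have [r hr] := cell_rowB (ha _ S) (hb _ S).
by exists r => T; rewrite mulrBl.
Qed.

(** Left multiplication by [a] keeps or lowers the cell, so it preserves the span over a down-closed
    set of indices. *)
Lemma cellular_in_cells P a x : cellular a ->
  (forall lam mu, P lam -> (mu < lam)%O -> P mu) ->
  in_cells P x -> in_cells P (a * x).
Proof.
move=> ha Pdown [c ->]; have hP := in_cells_zmod P.
rewrite mulr_sumr; apply: zmod_pred_sum => // mu Pmu.
rewrite mulr_sumr; apply: zmod_pred_sum => // S _.
rewrite mulr_sumr; apply: zmod_pred_sum => // T _.
rewrite -scalerAr; apply: in_cellsZ; have [r /(_ T)] := ha _ S.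
move/(in_cells_sub (Pdown _ ^~ Pmu)) => h.
rewrite -[a * _](subrK (\sum_U r U *: C U T)); apply: zmod_predD => //.
by apply: zmod_pred_sum => // U _; apply/in_cellsZ/in_cells_elt.
Qed.

(** Coefficients multiply as matrices, and [a] sends the lower error of [b] to lower terms again. *)
Lemma cellularM a b : cellular a -> cellular b -> cellular (a * b).
Proof.
move=> ha hb lam S; have [r hr] := hb _ S.
have [r' hr'] := fin_all_exists (ha lam).
exists (fun V => \sum_U r U * r' U V) => T.
have hP := in_cells_zmod (fun mu => (mu < lam)%O).
have -> : a * b * C S T - \sum_V (\sum_U r U * r' U V) *: C V T =
    a * (b * C S T - \sum_U r U *: C U T) +
    \sum_U r U *: (a * C U T - \sum_V r' U V *: C V T).
  have -> : \sum_U r U *: (a * C U T - \sum_V r' U V *: C V T) =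
      a * (\sum_U r U *: C U T) - \sum_V (\sum_U r U * r' U V) *: C V T.
    rewrite mulr_sumr; under [X in _ = _ - X]eq_bigr do rewrite scaler_suml.
    rewrite exchange_big -sumrB; apply: eq_bigr => U _.
    rewrite scalerBr scalerAr scaler_sumr; congr (_ - _).
    by apply: eq_bigr => V _; rewrite scalerA.
  by rewrite mulrBr mulrA addrA subrK.
apply: zmod_predD => //.
  by apply: cellular_in_cells => // mu nu h1 h2; apply: lt_trans h2 h1.
by apply: zmod_pred_sum => // U _; apply: in_cellsZ.
Qed.

End CellComb.

(** * Axiom (3) and spanning for the Schur algebra *)

Section CellularBasis.
Variables (E : finType) (M : matroid E) (ell : flat M -> flat M -> E).
Hypothesis hell : labelling ell.
Implicit Types (K L X Y : flat M) (s t : seq (flat M)) (a b : schur_algebra M).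

Local Notation N := (fun K : flat M => neat_flag ell K).
Local Notation C := (fun (K : flat M) (F G : neat_flag ell K) => cell_elt F G).

Lemma schur_iotaB : zmod_morphism (@schur_iota E M).
Proof.
move=> a b; rewrite -(to_schur_reprK a) -(to_schur_reprK b) -raddfB !schur_iotaE.
by rewrite !raddfB.
Qed.

Lemma schur_iotaM a b : schur_iota (a * b) = schur_iota b * schur_iota a.
Proof.
rewrite -(to_schur_reprK a) -(to_schur_reprK b) -rmorphM !schur_iotaE.
by rewrite path_revM rmorphM.
Qed.

Lemma schur_iotaK : involutive (@schur_iota E M).
Proof. by move=> a; rewrite -(to_schur_reprK a) !schur_iotaE path_revK. Qed.

Lemma neat_flag_spath K (F : neat_flag ell K) :
  to_schur << nf_path F >> = spath (fp_head F) (fp_tail F).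
Proof. by rewrite pelE. Qed.

Lemma neat_flag_down K (F : neat_flag ell K) : downflag K (fp_head F) (fp_tail F).
Proof.
have /andP[lF pF] := valP F; rewrite /downflag lF andbT.
by apply: sub_path pF => X Y /andP[].
Qed.

(** Each half is a down flag ending at [K] and is straightened with the other half held fixed. *)
Lemma in_cells_down (P : pred (flat M)) K X s Y t :
  P K -> downflag K X s -> downflag K Y t ->
  in_cells (N := N) C P (spath X s * schur_iota (spath Y t)).
Proof.
move=> PK ds dt; have hP := in_cells_zmod (N := N) C P.
apply: (neat_reduce hell (P := fun x => in_cells (N := N) C P
    (x * schur_iota (spath Y t))) _ ds) => [|U _].
  by apply: zmod_pred_comp => // x y; rewrite mulrBl.
apply: (neat_reduce hell (P := fun y => in_cells (N := N) C P
    (to_schur << nf_path U >> * schur_iota y)) _ dt) => [|V _].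
  by apply: zmod_pred_comp => // x y; rewrite schur_iotaB mulrBr.
exact: (in_cells_elt (N := N) C).
Qed.

(** With the right factor split off, straightening [a] yields coefficients that cannot depend on
    [T], as axiom (3) demands. *)
Definition row_pred K a : Prop :=
  cell_row (N := N) C (lam := K)
    (fun T => a * schur_iota (to_schur << nf_path T >>)).

Lemma row_pred_zmod K : zmod_pred (row_pred K).
Proof.
split=> [|x y hx hy].
  apply: cell_row_low => T; rewrite mul0r.
  exact: (in_cells_zmod (N := N) C _).1.
have [r hr] := cell_rowB hx hy; exists r => T; rewrite mulrBl; exact: hr.
Qed.

Lemma row_pred_down K X s : downflag K X s -> row_pred K (spath X s).
Proof.
move=> ds; apply: (neat_reduce hell (row_pred_zmod K) ds) => U _.
exact: (cell_row_elt (N := N) C U).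
Qed.

(** A down-step lengthens the left flag of the cell element. An up-step is pushed to the base [J],
    where what survives factors through some A < J. *)
Lemma cellular_step K L : cellular (N := N) C (spath K [:: L]).
Proof.
case aKL: (adj K L); last first.
  rewrite /spath pelF ?raddf0 /= ?aKL //.
  exact: (cellular_zmod (N := N) C).1.
move=> J S; suff [r hr]: row_pred J (spath K [:: L] * to_schur << nf_path S >>).
  by exists r => T; rewrite /cell_elt mulrA; apply: hr.
rewrite neat_flag_spath; have dS := neat_flag_down S.
case: (L =P fp_head S) => [eL|/eqP neL]; last first.
  by rewrite spathM /= (negPf neL); apply: (row_pred_zmod _).1.
rewrite {L}eL in aKL *; case/orP: aKL => [KL|LK]; last first.
  by rewrite spathM eqxx; apply: row_pred_down; rewrite downflag_cons LK.
apply: (up_downflag (row_pred_zmod J) dS KL) => [s ds|A s AJ ds].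
  exact: row_pred_down.
apply: cell_row_low => T; rewrite -mulrA.
(* The surviving step from [A] to [J] is absorbed into the right flag, which now ends at [A]. *)
have -> : spath A [:: J] * schur_iota (to_schur << nf_path T >>) =
    schur_iota (spath (fp_head T) (rcons (fp_tail T) A)).
  have /andP[/eqP lT _] := valP T.
  rewrite -[in LHS](schur_iotaK (spath A _)) -schur_iotaM neat_flag_spath.
  by rewrite spath_iota /= spathM -/(fp_last _) lT eqxx cats1.
apply: in_cells_down ds _; first exact: covers_lt.
have /andP[pT /eqP lT] := neat_flag_down T.
by rewrite /downflag rcons_path last_rcons pT lT eqxx /down AJ.
Qed.

Lemma neat_nil K : neat ell K (FlagPath (fp_pair := (K, [::])) isT).
Proof. by rewrite /neat /fp_last /= eqxx. Qed.

Lemma cell_elt_nil K :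
  cell_elt (NeatFlag (neat_nil K)) (NeatFlag (neat_nil K)) = spath K [::].
Proof. by rewrite cell_eltE. Qed.

Lemma schur_one : \sum_(K : flat M) spath K [::] = 1.
Proof. by rewrite -raddf_sum. Qed.

Lemma cellular_spath K s : cellular (N := N) C (spath K s).
Proof.
elim: s K => [|L s IH] K; last first.
  by rewrite spath_cons; apply: cellularM; first exact: cellular_step.
move=> J S; suff h: row_pred J (spath K [::] * to_schur << nf_path S >>).
  by have [r hr] := h; exists r => T; rewrite /cell_elt mulrA; apply: hr.
rewrite neat_flag_spath spathM; case: eqP => [/= ->|_].
  exact/row_pred_down/neat_flag_down.
exact: (row_pred_zmod _).1.
Qed.

Lemma cellular_all a : cellular (N := N) C a.
Proof.
rewrite -(to_schur_reprK a); move: (repr a); apply: malg_ind => [|p].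
  apply: (zmod_pred_comp (cellular_zmod (N := N) C) (f := @to_schur E M)).
  exact: raddfB.
by rewrite pelE; apply: cellular_spath.
Qed.

(** The unit is the sum of the cell elements of trivial flags, and [cellular_in_cells] applies to
    [a * 1]. *)
Lemma in_cells_all a : in_cells (N := N) C predT a.
Proof.
rewrite -[a]mulr1 -schur_one; apply: cellular_in_cells => //.
  exact: cellular_all.
apply: zmod_pred_sum => [|K _]; first exact: in_cells_zmod.
by rewrite -cell_elt_nil; apply: (in_cells_elt (N := N) C).
Qed.

End CellularBasis.

(** * Exterior products and contractions *)

Section Fock.
Variables (E : finType).
Implicit Types (w : E -> int) (f g : seq E -> int) (e : E) (s : seq E).

(* A k-vector is an alternating function on k-tuples of E; this is the product
   w /\ f, expanded along the first entry of the tuple. *)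
Fixpoint wedge w f s : int :=
  if s is e :: s' then w e * f s' - wedge w (fun t => f (e :: t)) s' else 0.

(** Interior product with [w], for the standard pairing on functions on [E]. *)
Definition contract w f s : int := \sum_e w e * f (e :: s).

Definition alternating f : Prop :=
  forall a b (e e' : E), f (a ++ [:: e, e' & b]) = - f (a ++ [:: e', e & b]).

Lemma wedgeB w f g s : wedge w (fun t => f t - g t) s = wedge w f s - wedge w g s.
Proof.
elim: s f g => [|e s IH] f g /=; first by rewrite subrr.
by rewrite IH mulrBr !opprB addrACA [RHS]addrACA [- _ - _]addrC.
Qed.

Lemma wedgeBl w w' f s : wedge (fun e => w e - w' e) f s = wedge w f s - wedge w' f s.
Proof.
elim: s f => [|e s IH] f /=; first by rewrite subrr.
by rewrite IH mulrBl !opprB addrACA [RHS]addrACA [- _ - _]addrC.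
Qed.

Lemma eq_wedge w w' f g s : w =1 w' -> f =1 g -> wedge w f s = wedge w' g s.
Proof.
move=> eqw; elim: s f g => [|e s IH] f g eqf //=.
by rewrite eqw eqf (IH _ (fun t => g (e :: t))).
Qed.

Lemma wedge0 w s : wedge w (fun _ => 0) s = 0.
Proof. by elim: s => //= e s ->; rewrite mulr0 subrr. Qed.

Lemma wedge0l f s : wedge (fun _ => 0) f s = 0.
Proof. by elim: s f => //= e s IH f; rewrite IH mul0r subrr. Qed.

Lemma wedge_sum (I : Type) (r : seq I) (P : pred I) w (F : I -> seq E -> int) s :
  wedge w (fun t => \sum_(i <- r | P i) F i t) s =
  \sum_(i <- r | P i) wedge w (F i) s.
Proof.
elim: s F => [|e s IH] F /=; first by rewrite big1.
by rewrite IH mulr_sumr -sumrB.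
Qed.

Lemma wedge_suml (I : Type) (r : seq I) (P : pred I) (W : I -> E -> int) f s :
  wedge (fun e => \sum_(i <- r | P i) W i e) f s =
  \sum_(i <- r | P i) wedge (W i) f s.
Proof.
elim: s f => [|e s IH] f /=; first by rewrite big1.
by rewrite IH mulr_suml -sumrB.
Qed.

Lemma wedgeZ w k f s : wedge w (fun t => k * f t) s = k * wedge w f s.
Proof.
elim: s f => [|e s IH] f /=; first by rewrite mulr0.
by rewrite IH mulrBr mulrCA.
Qed.

Lemma wedge_wedge w f s : wedge w (wedge w f) s = 0.
Proof.
elim: s f => [|e s IH] f //=; rewrite wedgeB wedgeZ IH subr0 subrr //.
Qed.

Lemma contractB w f g s :
  contract w (fun t => f t - g t) s = contract w f s - contract w g s.
Proof. by rewrite -sumrB; apply: eq_bigr => e _; rewrite mulrBr. Qed.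

(** The Clifford relation: the scalar product becomes the factor |L \ K| of (/\), and the exchange
    of the operators gives its minus sign. *)
Lemma contract_wedge w w' f s :
  contract w (wedge w' f) s =
  (\sum_e w e * w' e) * f s - wedge w' (contract w f) s.
Proof.
rewrite wedge_sum mulr_suml -sumrB; apply: eq_bigr => e _ /=.
by rewrite wedgeZ mulrBr mulrA.
Qed.

(** Swapping the two inserted entries changes the sign, so the value equals its own opposite, hence
    is 0 in [int]. *)
Lemma contract_contract w f s : alternating f -> contract w (contract w f) s = 0.
Proof.
move=> altf; have : contract w (contract w f) s = - contract w (contract w f) s.
  rewrite {1}/contract; under eq_bigr do rewrite mulr_sumr.
  rewrite exchange_big -sumrN; apply: eq_bigr => e _ /=.
  rewrite mulr_sumr -sumrN; apply: eq_bigr => e' _.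
  by rewrite (altf [::]) !mulrN mulrCA.
by move=> h; apply/eqP; move/eqP: h; rewrite -subr_eq0 opprK -mulr2n mulrn_eq0.
Qed.

Lemma alternating_contract w f : alternating f -> alternating (contract w f).
Proof.
move=> altf a b e e'; rewrite -sumrN; apply: eq_bigr => x _.
by rewrite -!cat_cons altf mulrN.
Qed.

Lemma alternating_wedge w f : alternating f -> alternating (wedge w f).
Proof.
move=> altf a b e e'; elim: a f altf => [|x a IH] f altf /=; last first.
  rewrite (altf a) (IH (fun t => f (x :: t))) ?mulrN ?opprD //.
  by move=> c c' y y'; apply: (altf (x :: c)).
have -> : wedge w (fun t => f [:: e', e & t]) b = - wedge w (fun t => f [:: e, e' & t]) b.
  rewrite -mulN1r -wedgeZ; apply: eq_wedge => // t.
  by rewrite mulN1r (altf [::]).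
by rewrite opprK !opprB addrA.
Qed.

End Fock.

(** * The action with base flat B *)

Section Action.
Variables (E : finType) (M : matroid E) (B : flat M).
Implicit Types (K L X Y : flat M) (t : seq (flat M)) (e : E) (s : seq E).
Implicit Types (f g : seq E -> int) (v u : flat M -> seq E -> int).
Implicit Types (x y z : path_algebra M).

Definition ind L K e : int := (e \in fset_of L :\: fset_of K)%:R.

Definition up K L f s : int :=
  if (B <= K)%O && all [in fset_of K] s then contract (ind L K) f s else 0.

Definition step K L f : seq E -> int :=
  if covers K L then up K L f
  else if covers L K then wedge (ind K L) f else fun _ => 0.

Fixpoint act K t v : seq E -> int :=
  if t is L :: t' then step K L (act L t' v) else v K.

(** [v] has one component per flat; a path from K to L carries the component at L to the one at K,
    so concatenation becomes composition. *)
Definition Act x v K s : int :=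
  mlin (fun p => if fp_head p == K then act K (fp_tail p) v s else 0) x.

Lemma stepB K L f g s : step K L (fun r => f r - g r) s = step K L f s - step K L g s.
Proof.
rewrite /step /up; case: ifP => _; first by case: ifP => _; rewrite ?contractB ?subrr.
by case: ifP => _; rewrite ?wedgeB ?subrr.
Qed.

Lemma step0 K L s : step K L (fun _ => 0) s = 0.
Proof.
have := stepB K L (fun _ => 0) (fun _ => 0) s; rewrite subrr => ->.
by rewrite subrr.
Qed.

Lemma actB K t v u s :
  act K t (fun X r => v X r - u X r) s = act K t v s - act K t u s.
Proof.
elim: t K s => [|L t IH] K s //=; rewrite -stepB; congr (step K L _ s).
exact: boolp.funext.
Qed.

Lemma act_cat K t t' v : act K (t ++ t') v = act K t (fun X => act X t' v).
Proof. by elim: t K => //= L t IH K; rewrite IH. Qed.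

Lemma act_last K t v u : v (last K t) = u (last K t) -> act K t v = act K t u.
Proof. by elim: t K => //= L t IH K /IH ->. Qed.

Lemma act0 K t v s : (forall r, v (last K t) r = 0) -> act K t v s = 0.
Proof.
move=> v0; rewrite (@act_last _ _ v (fun _ _ => 0)); last exact: boolp.funext.
have := actB K t (fun _ _ => 0) (fun _ _ => 0) s; rewrite subrr => ->.
by rewrite subrr.
Qed.

Lemma act_npath K t v s : path (@adj E M) K t = false -> act K t v s = 0.
Proof.
elim: t K s => //= L t IH K s; rewrite /step /adj.
case: ifP => [_|_] /=.
  move/IH => a0; rewrite -[RHS](_ : up K L (fun _ => 0) s = 0).
    by congr (up K L _ s); apply: boolp.funext.
  rewrite /up; case: ifP => // _; apply: big1 => e _; exact: mulr0.
case: ifP => // _ /IH a0; rewrite -[RHS](wedge0 (ind K L) s).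
by congr (wedge _ _ s); apply: boolp.funext.
Qed.

Lemma Act_zmod v K s : zmod_morphism (fun x => Act x v K s).
Proof. by move=> x y; rewrite /Act raddfB. Qed.

Lemma Act0 v K s : Act 0 v K s = 0.
Proof. exact: raddf0. Qed.

Lemma ActMn x n v K s : Act (x *+ n) v K s = Act x v K s *+ n.
Proof. exact: raddfMn. Qed.

Lemma ActN x v K s : Act (- x) v K s = - Act x v K s.
Proof. exact: raddfN. Qed.

Lemma Act_pel K t v L s : Act (pel K t) v L s = if K == L then act K t v s else 0.
Proof.
case Kt: (path (@adj E M) K t); last first.
  by rewrite (pelF Kt) (zm0 (Act_zmod v L s)); case: eqP => // _; rewrite act_npath.
have [p [-> pK pt]] := pelT Kt; rewrite /Act mlinU pK pt.
by case: eqP => // ->.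
Qed.

Lemma ActB x v u K s :
  Act x (fun X r => v X r - u X r) K s = Act x v K s - Act x u K s.
Proof.
move: x; apply: (@mlin_ext _ _ (fun x => Act x (fun X r => v X r - u X r) K s)
  (fun x => Act x v K s - Act x u K s)).
- exact: Act_zmod.
- by move=> x y; rewrite !Act_zmod !opprB addrACA [RHS]addrACA [- _ - _]addrC.
move=> p; rewrite pelE !Act_pel; case: eqP => _; first exact: actB.
by rewrite subrr.
Qed.

Lemma Act0r x K s : Act x (fun _ _ => 0) K s = 0.
Proof.
have := ActB x (fun _ _ => 0) (fun _ _ => 0) K s; rewrite subrr => ->.
by rewrite subrr.
Qed.

Lemma ActM x y v K s : Act (x * y) v K s = Act x (Act y v) K s.
Proof.
apply: (bilin_ext (f1 := fun x y => Act (x * y) v K s)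
  (f2 := fun x y => Act x (Act y v) K s)) => [z|z|z|z|p q].
- by move=> x1 x2; rewrite mulrBl Act_zmod.
- by move=> x1 x2; rewrite mulrBr Act_zmod.
- exact: Act_zmod.
- move=> x1 x2; rewrite -ActB; congr (Act z _ K s).
  by apply: boolp.funext => X; apply: boolp.funext => r; rewrite Act_zmod.
rewrite !pelE pelM Act_pel; move: (fp_head p) (fp_tail p) (fp_head q) (fp_tail q).
move=> K1 t1 K2 t2; case: (_ =P K2) => [e12|ne12].
  rewrite Act_pel; case: eqP => // _; rewrite act_cat.
  congr (_ s); apply: act_last; apply: boolp.funext => r.
  by rewrite Act_pel e12 eqxx.
rewrite (zm0 (Act_zmod v K s)); case: eqP => // _; rewrite act0 // => r.
by rewrite Act_pel eq_sym; case: eqP.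
Qed.

(* As s lies in X, the bound on the rank says that s and B together span X. *)
Definition supported X f : Prop := forall s, f s != 0 ->
  [/\ (B <= X)%O, all [in fset_of X] s
    & (rho X <= rk M (fset_of B :|: [set e in s]))%N].

Definition good X f : Prop := alternating f /\ supported X f.

Lemma good_zmod_closed X f g : good X f -> good X g -> good X (fun s => f s - g s).
Proof.
move=> [altf sf] [altg sg]; split=> [a b e e'|s].
  by rewrite altf altg opprB opprK addrC.
by case: (f s =P 0) => [->|/eqP/sf //]; rewrite sub0r oppr_eq0 => /sg.
Qed.

Lemma good0 X : good X (fun _ => 0).
Proof. by split=> [a b e e'|s] /=; rewrite ?oppr0 ?eqxx. Qed.

Lemma wedge_neq0 (w : E -> int) f s : wedge w f s != 0 ->
  exists s1 e s2, [/\ s = s1 ++ e :: s2, w e != 0 & f (s1 ++ s2) != 0].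
Proof.
elim: s f => [|e s IH] f /=; first by [].
have [z|nz _] := eqVneq (w e * f s) 0.
  rewrite z sub0r oppr_eq0 => /IH[s1 [e' [s2 [-> we fs]]]].
  by exists (e :: s1), e', s2.
by exists [::], e, s; move: nz; rewrite mulf_eq0 negb_or => /andP[].
Qed.

Lemma ind_neq0 L K e : ind L K e != 0 -> e \in fset_of L :\: fset_of K.
Proof. by rewrite /ind; case: (e \in _). Qed.

(** A point of L \ K raises the rank of a tuple that spans [K] with [B]. The vector [w] is general
    because both indicators and point masses at labels occur. *)
Lemma good_wedge K L (w : E -> int) f : covers K L ->
  (forall e, w e != 0 -> e \in fset_of L :\: fset_of K) ->
  good K f -> good L (wedge w f).
Proof.
move=> KL hw [altf sf]; split=> [|s]; first exact: alternating_wedge.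
move/wedge_neq0 => [s1 [e [s2 [-> /hw + /sf[BK sK rK]]]]].
rewrite inE => /andP[eK eL]; split.
- exact: le_trans BK (ltW (covers_lt KL)).
- move: sK; rewrite !all_cat /= => /andP[h1 h2]; rewrite eL /=.
  by apply/andP; split; [move: h1|move: h2]; apply: sub_all => z;
    apply: (subsetP (covers_sub KL)).
have -> : fset_of B :|: [set z in s1 ++ e :: s2] =
    e |: (fset_of B :|: [set z in s1 ++ s2]).
  apply/setP => z; rewrite !(inE, mem_cat).
  by do !case: (_ \in _) => //=; rewrite ?orbT ?orbF.
rewrite (covers_rho KL); apply: leq_ltn_trans (rK) _.
apply: (rkU1_gt eK) => //; rewrite subUset; apply/andP; split; first exact: BK.
by apply/subsetP => z; rewrite inE; apply: (allP sK).
Qed.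

(** A nonzero contraction has a nonzero term [f (e :: s)], and dropping [e] lowers the rank by at
    most one. *)
Lemma good_up K L f : covers K L -> good L f -> good K (up K L f).
Proof.
move=> KL [altf sf]; split=> [a b e e'|s].
  rewrite /up; have -> : all [in fset_of K] (a ++ [:: e', e & b]) =
      all [in fset_of K] (a ++ [:: e, e' & b]).
    by rewrite !all_cat; congr (_ && _); apply: andbCA.
  by case: ifP => _; rewrite ?oppr0 // alternating_contract.
rewrite /up; case: ifP => [/andP[BK sK] nz|]; last by rewrite eqxx.
split=> //; have [e /sf [_ _]] : exists e, f (e :: s) != 0.
  apply/existsP; apply: contraNT nz; rewrite negb_exists => /forallP f0.
  by rewrite /contract big1 // => e _; have /negbNE/eqP -> := f0 e; rewrite mulr0.
rewrite set_cons setUCA (covers_rho KL) => r1.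
by rewrite -ltnS; apply: leq_trans r1 (rkU1_le _ _ _).
Qed.

Lemma good_step K L f : good L f -> good K (step K L f).
Proof.
move=> gf; rewrite /step; case: ifP => [KL|_]; first exact: good_up.
case: ifP => [LK|_]; last exact: good0.
by apply: good_wedge LK _ gf => e; apply: ind_neq0.
Qed.

Lemma good_Act x v : (forall X, good X (v X)) -> forall X, good X (Act x v X).
Proof.
move=> gv; move: x; apply: malg_ind => [|p X].
  split=> [X|x y gx gy X].
    rewrite (_ : Act 0 v X = fun _ => 0); first exact: good0.
    by apply: boolp.funext => s; rewrite (zm0 (Act_zmod v X s)).
  rewrite (_ : Act (x - y) v X = fun s => Act x v X s - Act y v X s).
    exact: good_zmod_closed.
  by apply: boolp.funext => s; rewrite Act_zmod.
rewrite pelE; move: (fp_head p) (fp_tail p) => K t.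
rewrite (_ : Act (pel K t) v X = if K == X then act K t v else fun _ => 0); last first.
  by apply: boolp.funext => s; rewrite Act_pel; case: ifP.
case: eqP => [<-|_]; last exact: good0.
by elim: t K => //= L t IH K; apply: good_step.
Qed.

End Action.

(** * The defining relations act as zero *)

Section Relations.
Variables (E : finType) (M : matroid E) (B : flat M).
Implicit Types (K L X Y : flat M) (t : seq (flat M)) (e : E) (s : seq E).
Implicit Types (f g : seq E -> int) (v u : flat M -> seq E -> int).

Lemma step_up K L f : covers K L -> step B K L f = up B K L f.
Proof. by rewrite /step => ->. Qed.

Lemma step_down K L f : covers L K -> step B K L f = wedge (ind K L) f.
Proof.
move=> LK; rewrite /step LK; case: ifP => // /covers_lt KL.
by have := lt_trans KL (covers_lt LK); rewrite ltxx.
Qed.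

Lemma eq_wedge_in (P : pred E) (w w' : E -> int) f g s :
  (forall e, P e -> w e = w' e) -> (forall r, all P r -> f r = g r) ->
  all P s -> wedge w f s = wedge w' g s.
Proof.
move=> eqw; elim: s f g => [|e s IH] f g eqf //= /andP[Pe Ps].
rewrite eqw // eqf // (IH _ (fun r => g (e :: r))) // => r Pr.
by apply: eqf; rewrite /= Pe.
Qed.

(** A tuple inside [Y], even together with [B], has too small a rank to span [X]. *)
Lemma supported0 X Y f s : supported B X f -> (rho Y < rho X)%N -> (B <= Y)%O ->
  all [in fset_of Y] s -> f s = 0.
Proof.
move=> sf YX BY sY; apply/eqP; apply: contraTT YX => /sf[_ _ rX].
rewrite -leqNgt; apply: leq_trans rX _; apply: rk_mono; rewrite subUset.
by apply/andP; split; [exact: BY|apply/subsetP => z; rewrite inE; apply: (allP sY)].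
Qed.

Lemma supported_out X f s e : supported B X f -> e \in s -> e \notin fset_of X -> f s = 0.
Proof.
move=> sf es eX; apply/eqP; apply: contraNT eX => /sf[_ /allP sX _].
exact: sX.
Qed.

Lemma covers_ind_sum L K e : (L < K)%O -> rho K = (rho L).+2 ->
  \sum_(X | covers L X && covers X K) ind X L e = ind K L e.
Proof.
move=> LK rK; rewrite {2}/ind; case: (boolP (e \in _)) => [eKL|eKL].
  have [X [LX XK eX]] := between_exists LK rK eKL.
  have eL : e \notin fset_of L by move: eKL; rewrite inE => /andP[].
  rewrite (bigD1 X) ?LX //= big1 => [|Y /andP[/andP[LY _] neY]].
    by rewrite /ind inE eL eX addr0.
  rewrite /ind inE eL; case: (boolP (e \in _)) => //= eY.
  by rewrite (covers_common LX LY eL eX eY) eqxx in neY.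
apply: big1 => X /andP[_ XK]; rewrite /ind; case: (boolP (e \in _)) => // eX.
case/negP: eKL; move: eX; rewrite !inE => /andP[-> /=].
exact: (subsetP (covers_sub XK)).
Qed.

(** Since 1_(K \ X) = 1_(K \ L) - 1_(X \ L) and squares vanish, K \ X may be replaced by K \ L.
    Summing over X then leaves the square of 1_(K \ L). *)
Lemma FS_down_act L K f s : (L < K)%O -> rho K = (rho L).+2 ->
  \sum_(X | covers L X && covers X K) wedge (ind K X) (wedge (ind X L) f) s = 0.
Proof.
move=> LK rK; rewrite (eq_bigr (fun X => wedge (ind K L) (wedge (ind X L) f) s)).
  rewrite -wedge_sum -[RHS](wedge_wedge (ind K L) f s); apply: eq_wedge => // r.
  by rewrite -wedge_suml; apply: eq_wedge => // e; apply: covers_ind_sum.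
move=> X /andP[LX XK]; rewrite -[RHS]subr0 -[in RHS](wedge_wedge (ind X L) f s).
rewrite -wedgeBl; apply: eq_wedge => // e; rewrite /ind !inE.
have := subsetP (covers_sub XK) e; have := subsetP (covers_sub LX) e.
case: (e \in fset_of L); case: (e \in fset_of X); case: (e \in fset_of K);
  move=> LX' XK' //=; by [have := LX' isT|have := XK' isT|rewrite ?subr0 ?subrr].
Qed.

(** The sum is compared with the double contraction by 1_(K \ L), which vanishes. *)
Lemma FS_up_act L K f s : (L < K)%O -> rho K = (rho L).+2 -> good B K f ->
  \sum_(X | covers L X && covers X K) up B L X (up B X K f) s = 0.
Proof.
move=> LK rK [altf sf].
have [/andP[BL sL]|nBs] := boolP ((B <= L)%O && all [in fset_of L] s); last first.
  by apply: big1 => X _; rewrite /up (negPf nBs).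
rewrite -[RHS](contract_contract (ind K L) s altf).
rewrite (eq_bigr (fun X => \sum_e \sum_e' ind X L e * (ind K X e' * f [:: e', e & s]))).
  rewrite exchange_big; apply: eq_bigr => e _; rewrite mulr_sumr exchange_big.
  apply: eq_bigr => e' _; rewrite -(covers_ind_sum e LK rK) mulr_suml.
  apply: eq_bigr => X /andP[LX XK]; rewrite {1 3}/ind.
  case: (boolP (e \in _)) => eX; rewrite ?mul0r // !mul1r.
  have [e'X|e'X] := boolP (e' \in fset_of X); last first.
    have e'L : e' \notin fset_of L.
      by apply: contra e'X; apply: (subsetP (covers_sub LX)).
    by rewrite /ind !inE e'X e'L.
  (* The extra terms have both new points in [X], so their tuples cannot span [K]. *)
  suff -> : f [:: e', e & s] = 0 by rewrite !mulr0.
  apply: (supported0 (Y := X) sf); first exact/flat_lt_rho/covers_lt.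
    exact: le_trans BL (ltW (covers_lt LX)).
  move: eX; rewrite inE /= e'X => /andP[_ ->] /=.
  by apply: sub_all sL => z; apply: (subsetP (covers_sub LX)).
move=> X /andP[LX XK]; rewrite /up BL sL; apply: eq_bigr => e _.
rewrite -mulr_sumr {1 3}/ind; case: (boolP (e \in _)) => eX; rewrite ?mul0r // !mul1r.
rewrite (le_trans BL (ltW (covers_lt LX))) /=.
move: eX; rewrite inE => /andP[_ ->] /=.
have -> // : all [in fset_of X] s.
by apply: sub_all sL => z; apply: (subsetP (covers_sub LX)).
Qed.

(** Only the scalar of the Clifford relation remains: [f] lives on tuples in [K], so contracting it
    by 1_(L \ K) gives 0. *)
Lemma wedge_act_eq K L f s : covers K L -> good B K f ->
  up B K L (wedge (ind L K) f) s = f s *+ #|fset_of L :\: fset_of K|.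
Proof.
move=> KL [altf sf]; rewrite /up; case: ifP => [_|/negbT nBs]; last first.
  suff -> : f s = 0 by rewrite mul0rn.
  by apply/eqP; apply: contraNT nBs => /sf[-> -> _].
rewrite contract_wedge (eq_wedge (w' := ind L K) (g := fun _ => 0)) //; last first.
  move=> r; apply: big1 => e _; rewrite /ind.
  case: (boolP (e \in _)) => eX; rewrite ?mul0r // mul1r.
  by apply: (supported_out sf (mem_head _ _)); move: eX; rewrite inE => /andP[].
rewrite wedge0 subr0 -mulr_natl; congr (_ * _).
rewrite -sum1_card natr_sum [RHS]big_mkcond; apply: eq_bigr => e _; rewrite /ind.
by case: (e \in _).
Qed.

(** Here the scalar term vanishes, since a tuple in both flats cannot span [K']. In the other term,
    L \ K' agrees with K \ I on [K], and L \ K agrees with K' \ I on [K']. *)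
Lemma wedge_act_neq K K' L f s : covers K L -> covers K' L -> K != K' ->
  good B K' f -> up B K L (wedge (ind L K') f) s =
  if covers (flatI K K') K then - wedge (ind K (flatI K K')) (up B (flatI K K') K' f) s
  else 0.
Proof.
move=> KL K'L ne gf; have [altf sf] := gf; set I := flatI K K'.
have IK : (I <= K)%O by apply: subsetIl.
have rKK' : rho K = rho K'.
  by have := covers_rho KL; rewrite (covers_rho K'L) => -[].
have rI : (rho I < rho K)%N.
  rewrite ltnNge; apply: contra ne => /(flat_rho_eq IK) eI.
  apply/eqP/flat_rho_eq; last by rewrite rKK'.
  by rewrite -eI; apply: subsetIr.
rewrite {1}/up; have [/andP[BK sK]|nBs] := boolP (_ && _); last first.
  case: ifP => // cI; symmetry; apply/eqP; rewrite oppr_eq0.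
  have IK' : covers I K' by rewrite -(covers_flatI KL K'L).
  have [_ sg] := good_wedge cI (@ind_neq0 _ _ K I) (good_up (B := B) IK' gf).
  by apply: contraNT nBs => /sg[-> ->].
have f0 r e : e \in r -> e \notin fset_of K' -> f r = 0 by apply: supported_out sf.
have BI : f =1 (fun _ => 0) \/ (B <= I)%O.
  have [BK'|nBK'] := boolP (B <= K')%O.
    by right; rewrite flat_leE subsetI; apply/andP.
  by left=> r; apply/eqP; apply: contraNT nBK' => /sf[].
rewrite contract_wedge.
have allI r : all [in fset_of K] r -> all [in fset_of K'] r -> all [in fset_of I] r.
  by move=> /allP h1 /allP h2; apply/allP => z zr; rewrite /= inE h1 // h2.
have fK r : all [in fset_of K] r -> f r = 0.
  move=> rK; case: BI => [->//|BI]; have [rK'|] := boolP (all [in fset_of K'] r).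
    by apply: (supported0 sf (Y := I)); rewrite -?rKK' // allI.
  by case/allPn => z; apply: f0.
rewrite (fK s) // mulr0 sub0r; case: ifP => cI; last first.
  apply/eqP; rewrite oppr_eq0; apply/eqP; rewrite -[RHS](wedge0 (ind L K') s).
  apply: (eq_wedge_in (P := [in fset_of K])) => // r rK.
  apply: big1 => e _; suff -> : f (e :: r) = 0 by rewrite mulr0.
  have [/andP[eK' rK']|] := boolP (all [in fset_of K'] (e :: r)); last first.
    by case/allPn => z; apply: f0.
  (* A nonzero value would make [r], which lies in [I], span with [B] all but one rank of [K'], so
     [K] would cover [I]. *)
  apply/eqP; apply: contraFT cI => /sf[BK' _]; rewrite set_cons setUCA => h.
  have /leq_trans/(_ (rkU1_le _ _ _)) {}h := h.
  have : (rk M (fset_of B :|: [set z in r]) <= rho I)%N.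
    apply: rk_mono; rewrite !subUset; apply/andP; split.
      by rewrite subsetI; apply/andP.
    by apply/subsetP => z; rewrite inE; apply: (allP (allI _ rK rK')).
  rewrite -ltnS => /(leq_trans h); rewrite -rKK' => h'.
  apply/coversP; split; last by apply/eqP; rewrite eqn_leq h'.
  by rewrite lt_neqAle IK andbT; apply/eqP => eI; rewrite eI ltnn in rI.
congr (- _); apply: (eq_wedge_in (P := [in fset_of K])) => // [e /= eK|r rK].
  by rewrite /ind !inE eK (subsetP (covers_sub KL)).
have -> : contract (ind L K) f r = contract (ind K' I) f r.
  apply: eq_bigr => e _; have [eK'|eK'] := boolP (e \in fset_of K'); last first.
    by rewrite (f0 _ e (mem_head _ _) eK') !mulr0.
  by rewrite /ind /I /= !inE eK' (subsetP (covers_sub K'L)) // !andbT.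
rewrite /up; case: ifP => // /negbT nBr; apply: big1 => e _.
suff -> : f (e :: r) = 0 by rewrite mulr0.
case: BI => [->//|BI]; rewrite BI /= in nBr.
have : ~~ all [in fset_of K'] (e :: r).
  by apply: contra nBr => /= /andP[_]; apply: allI.
by case/allPn => z; apply: f0.
Qed.

(** Good families thus form a module over S(M). The family [v] is quantified inside the induction
    because in [x * y] the factor [x] meets [Act B y v], again good by [good_Act]. *)
Lemma schur_ideal_Act x : schur_ideal x ->
  forall v, (forall X, good B X (v X)) -> forall K s, Act B x v K s = 0.
Proof.
elim=> {x} [x [L K LK r|L K LK r|K K' L KL K'L]
  ||x y _ x0 _ y0|x y _ y0|x y _ x0] v gv J s.
- rewrite (zm_sum (Act_zmod B v J s)).
  rewrite (eq_bigr (fun X => if L == J then up B L X (up B X K (v K)) s else 0)).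
    by case: eqP => _; [exact: FS_up_act|rewrite big1].
  by move=> X /andP[LX XK]; rewrite Act_pel /= !step_up.
- rewrite (zm_sum (Act_zmod B v J s)).
  rewrite (eq_bigr (fun X =>
    if K == J then wedge (ind K X) (wedge (ind X L) (v L)) s else 0)).
    by case: eqP => _; [exact: FS_down_act|rewrite big1].
  by move=> X /andP[LX XK]; rewrite Act_pel /= !step_down.
- rewrite Act_zmod Act_pel /= step_up // step_down //.
  have [<-|ne] := eqVneq K K'.
    rewrite ActMn Act_pel.
    by case: eqP => _; rewrite ?mul0rn ?subrr // wedge_act_eq // subrr.
  rewrite wedge_act_neq //; case: (boolP (covers _ K)) => cI; last first.
    by rewrite Act0 subr0; case: eqP.
  rewrite ActN Act_pel /= step_down // step_up; last by rewrite -(covers_flatI KL K'L).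
  by case: eqP => _; rewrite subrr.
- exact: (zm0 (Act_zmod B v J s)).
- by rewrite Act_zmod x0 // y0 // subrr.
- rewrite ActM (_ : Act B y v = fun _ _ => 0); last first.
    by apply: boolp.funext => X; apply: boolp.funext => r; apply: y0.
  exact: Act0r.
- by rewrite ActM x0 // => X; apply: good_Act.
Qed.

End Relations.

(** * Dual vectors of neat flags *)

Section Independence.
Variables (E : finType) (M : matroid E) (ell : flat M -> flat M -> E) (B : flat M).
Implicit Types (K L X Y Z : flat M) (t : seq (flat M)) (e : E) (s : seq E).
Implicit Types (f g : seq E -> int).

Definition vac s : int := (s == [::])%:R.

Definition single X f : flat M -> seq E -> int :=
  fun Z => if Z == X then f else fun _ => 0.

(** The wedge of point masses at the labels of the flats above [B]. *)
Fixpoint dual_vec X t : seq E -> int :=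
  if t is Y :: t' then wedge (fun e => (e == ell B X)%:R) (dual_vec Y t') else vac.

Definition neat_seq X t : bool := path (neat_step ell B) X t && (last X t == B).

Lemma neat_seq_cons X Y t :
  neat_seq X (Y :: t) = neat_step ell B X Y && neat_seq Y t.
Proof. by rewrite /neat_seq /= andbA. Qed.

Lemma neat_seq_down X t : neat_seq X t -> downflag B X t.
Proof.
by case/andP=> p l; rewrite /downflag l andbT; apply: sub_path p => Y Z /andP[].
Qed.

Lemma neat_seq_nil X t : neat_seq X t -> (X == B) = (t == [::]).
Proof.
case: t => [|Y t]; first by move/andP => [_ ->].
rewrite neat_seq_cons => /andP[/andP[YX _] /neat_seq_down/downflag_le BY].
by rewrite gt_eqF // (le_lt_trans BY (covers_lt YX)).
Qed.

Lemma good_vac : good B B vac.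
Proof.
split=> [a b e e'|s]; first by rewrite /vac; case: a => [|x a]; rewrite /= oppr0.
by rewrite /vac; case: s => //= _; split=> //; apply/rk_mono/subsetUl.
Qed.

Lemma good_single X f : good B X f -> forall Z, good B Z (single X f Z).
Proof. by move=> gf Z; rewrite /single; case: eqP => [->|_] //; apply: good0. Qed.

Lemma good_dual X t : neat_seq X t -> good B X (dual_vec X t).
Proof.
elim: t X => [|Y t IH] X /=.
  by move/neat_seq_nil; rewrite eqxx => /eqP->; apply: good_vac.
rewrite neat_seq_cons => /andP[/andP[YX eX] /IH]; apply: good_wedge => // e /=.
by case: (e =P ell B X) => [->|_].
Qed.

(** Such a tuple lies in the intersection of [X] and [Y], whose rank is smaller. *)
Lemma supported_neq X Y f s : supported B X f -> X != Y -> rho X = rho Y ->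
  all [in fset_of Y] s -> (B <= Y)%O -> f s = 0.
Proof.
move=> sf neXY rXY sY BY; apply/eqP; apply: contraT => nz; have [BX sX _] := sf _ nz.
case/eqP: nz; apply: (supported0 (Y := flatI X Y) sf).
- rewrite ltnNge; apply: contra neXY.
  move/(flat_rho_eq (subsetIl _ _ : flatI X Y <= X)%O) => eI.
  by apply/eqP/flat_rho_eq; [rewrite -eI; apply: subsetIr|rewrite rXY].
- by rewrite flat_leE subsetI; apply/andP.
by apply/allP => z zs; rewrite /= inE (allP sX) //= (allP sY).
Qed.

(** The label of [X] lies in X \ Y, so the Clifford scalar is 1 and the other term vanishes on
    tuples in [Y]. By [supported_neq], the remaining vector vanishes there unless Y = Y'. *)
Lemma up_dual X Y Y' t s : neat_step ell B X Y -> (B <= Y)%O ->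
  neat_seq X (Y' :: t) ->
  up B Y X (dual_vec X (Y' :: t)) s = if Y == Y' then dual_vec Y' t s else 0.
Proof.
move=> /andP[YX]; rewrite inE => /andP[eY eX] BY.
rewrite neat_seq_cons => /andP[/andP[Y'X eX'] /good_dual[_ sd]].
have rY : rho Y' = rho Y by have := covers_rho YX; rewrite (covers_rho Y'X) => -[].
rewrite /up BY; case: ifP => /= [sY|nsY]; last first.
  case: eqP => // eYY'; symmetry; apply/eqP; apply: contraFT nsY => /sd[_ sY' _].
  by rewrite eYY'.
rewrite contract_wedge (bigD1 (ell B X)) //= big1 => [|e /negPf->]; last first.
  by rewrite mulr0.
rewrite eqxx mulr1 addr0 {1}/ind inE eY eX mul1r.
rewrite (eq_wedge_in (P := [in fset_of Y]) (w' := fun _ => 0)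
  (g := contract (ind X Y) (dual_vec Y' t))) //; last first.
  by move=> e /= eY'; case: eqP => // ee; rewrite -ee eY' in eY.
rewrite wedge0l subr0; case: eqP => // /eqP neY.
by apply: (supported_neq sd _ rY); rewrite // eq_sym.
Qed.

Lemma rev_dual X t X' t' Z s : neat_seq X t -> neat_seq X' t' ->
  Act B (path_rev (pel X t)) (single X' (dual_vec X' t')) Z s =
  single B (fun r => if (X, t) == (X', t') then vac r else 0) Z s.
Proof.
elim: t X X' t' => [|Y t IH] X X' t' nX nX'.
  have XB : X = B by apply/eqP; rewrite (neat_seq_nil nX).
  rewrite XB path_revE /= Act_pel /= /single [B == Z]eq_sym.
  case: eqP => // _; rewrite xpair_eqE [B == X']eq_sym (neat_seq_nil nX').
  rewrite [[::] == _]eq_sym andbb.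
  by case: eqP => // ->.
move: nX; rewrite neat_seq_cons => /andP[nXY nY].
have YX : covers Y X by case/andP: nXY.
have BY := downflag_le (neat_seq_down nY).
have -> : pel X (Y :: t) = pel X [:: Y] * pel Y t by rewrite pelM eqxx.
(* Reversal makes the top step the rightmost factor, so it acts first and removes the first factor
   of the dual vector. *)
rewrite path_revM [path_rev (pel X [:: Y])]path_revE ActM.
have -> : Act B (pel (last X [:: Y]) (rev (belast X [:: Y])))
      (single X' (dual_vec X' t')) =
    fun Z s => if Y == Z then up B Y X (single X' (dual_vec X' t') X) s else 0.
  apply: boolp.funext => W; apply: boolp.funext => r.
  by rewrite Act_pel /= step_up.
have [eX|neX] := eqVneq X X'; last first.
  rewrite xpair_eqE (negPf neX) /=.
  rewrite (_ : (fun _ => _) = fun _ _ => 0) ?Act0r; last first.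
    apply: boolp.funext => W; apply: boolp.funext => r.
    rewrite /single (negPf neX) -(step_up B _ YX) step0; by case: ifP.
  by rewrite /single; case: ifP.
case: t' nX' => [|Y' t'] nX'.
  have := neat_seq_nil nX'; rewrite eqxx => /eqP XB; rewrite -eX in XB.
  by have := le_lt_trans BY (covers_lt YX); rewrite XB ltxx.
rewrite -eX in nX' *.
have nY' : neat_seq Y' t' by move: nX'; rewrite neat_seq_cons => /andP[].
have -> : (fun Z s =>
      if Y == Z then up B Y X (single X (dual_vec X (Y' :: t')) X) s else 0) =
   if Y == Y' then single Y' (dual_vec Y' t') else fun _ _ => 0.
  apply: boolp.funext => W; apply: boolp.funext => r.
  rewrite {1}/single eqxx up_dual //; have [->|_] := eqVneq Y Y'.
    by rewrite /single eq_sym; case: eqP.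
  by case: ifP.
have [eY|neY] := eqVneq Y Y'.
  by rewrite IH // eY !xpair_eqE eqseq_cons !eqxx.
by rewrite Act0r xpair_eqE eqseq_cons (negPf neY) andbF /single; case: ifP.
Qed.

Definition labels X t : seq E := [seq ell B Z | Z <- belast X t].

Lemma labels_sub X t : neat_seq X t -> all [in fset_of X] (labels X t).
Proof.
elim: t X => //= Y t IH X; rewrite neat_seq_cons => /andP[/andP[YX]].
rewrite inE => /andP[_ ->] /IH /=; apply: sub_all => z.
exact: (subsetP (covers_sub YX)).
Qed.

(** Only the first term of the wedge survives, as [ell B X] lies outside [Y]; the remaining labels
    lie in [Y'], so [supported_neq] forces Y = Y'. *)
Lemma act_labels X t t' : neat_seq X t -> neat_seq X t' ->
  act B X t (single B vac) (labels X t') = (t == t')%:R.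
Proof.
elim: t X t' => [|Y t IH] X [|Y' t'] nX nX'.
- by rewrite /= /single (neat_seq_nil nX).
- by have := neat_seq_nil nX'; rewrite (neat_seq_nil nX).
- by have := neat_seq_nil nX; rewrite (neat_seq_nil nX').
move: nX nX'; rewrite !neat_seq_cons => /andP[/andP[YX eX] nY] /andP[/andP[Y'X _] nY'].
rewrite /= step_down //= {1}/ind eX mul1r.
have [_ sf] : good B Y (act B Y t (single B vac)).
  have := good_Act (pel Y t) (good_single good_vac) Y.
  rewrite (_ : Act _ _ _ _ = act B Y t (single B vac)) //.
  by apply: boolp.funext => r; rewrite Act_pel eqxx.
rewrite (eq_wedge (w' := ind X Y) (g := fun _ => 0)) //; last first.
  move=> r; apply: (supported_out sf (mem_head _ _)).
  by move: eX; rewrite inE => /andP[].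
rewrite wedge0 subr0 eqseq_cons; have [eY|neY] := eqVneq Y Y'.
  by rewrite -eY in nY' *; rewrite IH.
apply: (supported_neq sf neY); last 2 first.
- exact: labels_sub.
- exact: downflag_le (neat_seq_down nY').
by have := covers_rho YX; rewrite (covers_rho Y'X) => -[].
Qed.

End Independence.

(** * Linear independence of the cell elements *)

Section Freeness.
Variables (E : finType) (M : matroid E) (ell : flat M -> flat M -> E).
Implicit Types (K L X : flat M).

Local Notation N := (fun K : flat M => neat_flag ell K).
Local Notation C := (fun (K : flat M) (F G : neat_flag ell K) => cell_elt F G).

Lemma neat_flag_seq K (F : neat_flag ell K) : neat_seq ell K (fp_head F) (fp_tail F).
Proof. by rewrite /neat_seq andbC; apply: (valP F). Qed.

Lemma neat_flag_eq K (F G : neat_flag ell K) :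
  ((fp_head F, fp_tail F) == (fp_head G, fp_tail G)) = (F == G).
Proof. by rewrite /fp_head /fp_tail -!surjective_pairing !(inj_eq val_inj). Qed.

Definition cell_lift K (F G : neat_flag ell K) : path_algebra M :=
  pel (fp_head F) (fp_tail F) * path_rev (pel (fp_head G) (fp_tail G)).

Lemma to_schur_lift K (F G : neat_flag ell K) : to_schur (cell_lift F G) = cell_elt F G.
Proof. by rewrite /cell_elt schur_iotaE -rmorphM !pelE. Qed.

(** The reversed flag sends the dual vector of [G'] to the vacuum or to 0, and [F] then rebuilds a
    vector that is tested on the labels of [F']. *)
Lemma Act_lift K (F G F' G' : neat_flag ell K) :
  Act K (cell_lift F G) (single (fp_head G') (dual_vec ell K (fp_head G') (fp_tail G')))
    (fp_head F') (labels ell K (fp_head F') (fp_tail F')) =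
  ((F == F') && (G == G'))%:R.
Proof.
rewrite /cell_lift ActM.
rewrite (_ : Act K (path_rev _) _ =
  single K (fun r => if G == G' then vac r else 0)); last first.
  apply: boolp.funext => Z; apply: boolp.funext => r.
  rewrite (rev_dual _ _ (neat_flag_seq G) (neat_flag_seq G')).
  by rewrite neat_flag_eq.
case: eqP => _; last first.
  rewrite andbF (_ : single K _ = fun _ _ => 0) ?Act0r //.
  by apply: boolp.funext => Z; rewrite /single; case: ifP.
rewrite andbT Act_pel -neat_flag_eq xpair_eqE; case: eqP => //= eFF'.
rewrite -eFF' act_labels //; first exact: neat_flag_seq.
by rewrite eFF'; apply: neat_flag_seq.
Qed.

(** The path passes through [K], where a good vector is zero unless [K] contains [B]. *)
Lemma Act_lift_out B K (F G : neat_flag ell K) v L s :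
  (forall X, good B X (v X)) -> ~~ (B <= K)%O -> Act B (cell_lift F G) v L s = 0.
Proof.
move=> gv nBK; rewrite /cell_lift ActM Act_pel; case: eqP => // _.
apply: act0 => r; have /andP[_ /eqP ->] := neat_flag_seq F.
have [_ sf] := good_Act (path_rev (pel (fp_head G) (fp_tail G))) gv K.
by apply/eqP; apply: contraNT nBK => /sf[].
Qed.

Lemma cell_comb_free (c : forall K : flat M, neat_flag ell K -> neat_flag ell K -> int) :
  cell_comb (N := N) C predT c = 0 -> forall K S T, c K S T = 0.
Proof.
move=> c0; pose x := \sum_K \sum_(S : N K) \sum_(T : N K) cell_lift S T *~ c K S T.
have Ix : schur_ideal x.
  have /eqP/to_schur_eqP : to_schur x = to_schur 0; last by rewrite subr0.
  rewrite raddf0 -[RHS]c0 raddf_sum; apply: eq_bigr => K _.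
  rewrite raddf_sum; apply: eq_bigr => S _; rewrite raddf_sum.
  by apply: eq_bigr => T _; rewrite raddfMz /= to_schur_lift.
(* Descending induction on rank: [n] bounds the distance from [rho K] to #|E| + 1, and n = 0 is
   impossible. *)
suff cn n K : (#|E| < rho K + n)%N -> forall S T, c K S T = 0.
  by move=> K; apply: (cn #|E|.+1 K); rewrite addnS ltnS leq_addl.
elim: n K => [|n IH] K ltn S T.
  by move: ltn; rewrite addn0 ltnNge (leq_trans (rk_card _ _)) ?max_card.
pose v := single (fp_head T) (dual_vec ell K (fp_head T) (fp_tail T)).
have gv X : good K X (v X) by apply/good_single/good_dual/neat_flag_seq.
have := schur_ideal_Act Ix gv (fp_head S) (labels ell K (fp_head S) (fp_tail S)).
have ActMz y m : Act K (y *~ m) v (fp_head S) (labels ell K (fp_head S) (fp_tail S)) =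
    Act K y v (fp_head S) (labels ell K (fp_head S) (fp_tail S)) *~ m.
  exact: raddfMz.
have AZ := Act_zmod K v (fp_head S) (labels ell K (fp_head S) (fp_tail S)).
rewrite (zm_sum AZ) (bigD1 K) //= [X in _ + X]big1 => [|L neL]; last first.
  rewrite (zm_sum AZ) big1 // => S' _; rewrite (zm_sum AZ) big1 // => T' _.
  have [KL|nKL] := boolP (K <= L)%O; last by rewrite ActMz Act_lift_out ?mul0rz.
  rewrite IH ?mulr0z ?Act0 //; apply: leq_trans ltn _.
  rewrite addnS -addSn leq_add2r; apply: flat_lt_rho.
  by rewrite lt_neqAle eq_sym neL.
rewrite addr0 (zm_sum AZ) (bigD1 S) //= [X in _ + X]big1 => [|S' neS]; last first.
  rewrite (zm_sum AZ) big1 // => T' _.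
  by rewrite ActMz Act_lift (negPf neS) mul0rz.
rewrite addr0 (zm_sum AZ) (bigD1 T) //= [X in _ + X]big1 => [|T' neT]; last first.
  by rewrite ActMz Act_lift (negPf neT) andbF mul0rz.
by rewrite addr0 ActMz Act_lift !eqxx intz.
Qed.

End Freeness.

Theorem theorem8p4 (E : finType) (M : matroid E)
    (ell : flat M -> flat M -> E) (hell : labelling ell) :
  cell_datum (N := fun K : flat M => neat_flag ell K)
    (fun (K : flat M) (F G : neat_flag ell K) => cell_elt F G)
    (@schur_iota E M).
Proof.
split.
- by move=> K; apply/card_gt0P; exists (NeatFlag (neat_nil ell K)).
(* Scaling by [n] is the integer multiple, so additivity suffices. *)
- move=> n a b; have iB := @schur_iotaB E M.
  have iN (c : schur_algebra M) : schur_iota (- c) = - schur_iota c.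
    by have := iB 0 c; rewrite (zm0 iB) !sub0r.
  rewrite -{1}[b]opprK; transitivity (schur_iota (n *: a) - schur_iota (- b)).
    exact: iB.
  rewrite iN opprK; congr (_ + _).
  by have := zm_expand iB [:: a] id (fun _ => n); rewrite !big_seq1.
- exact: schur_iotaM.
- exact: schur_iotaK.
- exact: in_cells_all.
- exact: cell_comb_free.
- by move=> K S T; rewrite /cell_elt schur_iotaM schur_iotaK.
move=> K a; have [r hr] := fin_all_exists (cellular_all hell a (lam := K)).
(* The coefficients were chosen row by row for each [S], hence the transposition. *)
exists (fun U S => r S U) => S T; have [c hc] := hr S T.
by exists c; rewrite -hc addrC subrK.
Qed.
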